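(* Let $K$ be an algebraically closed field of characteristic $2$ and $G=\mathrm{SL}_2(K)$. Let $V$ be the $G$-module with $$V^*=\langle X^2,Y^2\rangle\oplus\bigoplus_{i=1}^{4}\langle X_i,Y_i\rangle .$$ Then $\dim V=10$, $V$ is self-dual ($V\cong V^*$), and the invariant ring $K[V]^{\mathrm{SL}_2(K)}$ is not Cohen-Macaulay. There is a $1$-cocycle of $G$ with values in the submodule $\langle X^2,Y^2\rangle\subseteq V^*=K[V]_1$ (so in degree $1$) which is nontrivial in $H^1(G,K[V])$ and is annihilated by the invariants $f_{12},f_{23},f_{34}\in K[V]_2^G$, where $f_{ij}=X_iY_j+X_jY_i$; these three elements form a partial homogeneous system of parameters in $K[V]^G$ which is not a regular sequence in $K[V]^G$.
   Context: Write $\sigma=\begin{pmatrix}a&b\\c&d\end{pmatrix}\in G$. Each $\langle X_i,Y_i\rangle$ is a copy of the natural $G$-module with basis $X_i,Y_i$ and action $\sigma X_i=aX_i+cY_i$, $\sigma Y_i=bX_i+dY_i$. With $\langle X,Y\rangle$ the natural module, $\langle X^2,Y^2\rangle$ is the $2$-dimensional submodule of the second symmetric power $S^2(\langle X,Y\rangle)$ with action $\sigma X^2=a^2X^2+c^2Y^2$, $\sigma Y^2=b^2X^2+d^2Y^2$; as a summand of $V^*$ its basis elements $X^2,Y^2$ are variables of degree $1$ in the polynomial ring $K[V]$. For a $G$-module $V$ (finite-dimensional, with linear algebraic action), $K[V]=S(V^* )=\bigoplus_{d\ge0}S^d(V^* )$ with induced $G$-action, $K[V]_d=S^d(V^* )$.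 A $1$-cocycle with values in a $G$-module $M$ is a morphism $g:G\to M$, $\sigma\mapsto g_\sigma$, with $g_{\sigma\tau}=\sigma(g_\tau)+g_\sigma$; it is a coboundary if $g_\sigma=(\sigma-1)v$ for a fixed $v\in M$; $H^1$ is cocycles modulo coboundaries (likewise for $K[V]$). An invariant $f\in K[V]^G$ annihilates $g$ if $\sigma\mapsto f g_\sigma$ is a coboundary in $K[V]$. For a noetherian connected graded commutative domain $R$ over $K$, a homogeneous system of parameters (hsop) is a set of homogeneous algebraically independent elements over whose generated subalgebra $R$ is a finitely generated module; a partial hsop is a set extendable to an hsop. $R$ is Cohen-Macaulay if it is free over the subalgebra generated by one (equivalently every) hsop. A sequence $f_1,\dots,f_r\in R$ is regular if $(f_1,\dots,f_r)\neq R$ and multiplication by $f_i$ is injective on $R/(f_1,\dots,f_{i-1})$ for all $i$. *)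

(* Defs.v *)
From HB Require Import structures.
From mathcomp Require Import all_boot all_order all_fingroup all_algebra.
From mathcomp Require Import mpoly.

Set Implicit Arguments.
Unset Strict Implicit.
Unset Printing Implicit Defensive.

Import GRing.Theory.
Local Open Scope ring_scope.

Record SL2 (K : fieldType) := MkSL2 { SL2val :> 'M[K]_2; _ : \det SL2val == 1 }.

HB.instance Definition _ (K : fieldType) := [isSub for @SL2val K].
HB.instance Definition _ (K : fieldType) := [Choice of SL2 K by <:].

Section SL2Group.
Variable K : fieldType.
Implicit Types s t u : SL2 K.

Lemma SL2_det s : \det (s : 'M_2) = 1.
Proof. by case: s => m /= /eqP. Qed.

Lemma SL2_unit s : (s : 'M_2) \in unitmx.
Proof. by rewrite unitmxE SL2_det unitr1. Qed.

Fact SL2_one_subproof : \det (1%:M : 'M[K]_2) == 1.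
Proof. by rewrite det1. Qed.
Fact SL2_mul_subproof s t : \det ((s : 'M_2) *m t) == 1.
Proof. by rewrite det_mulmx !SL2_det mulr1. Qed.
Fact SL2_inv_subproof s : \det (invmx (s : 'M_2)) == 1.
Proof. by rewrite det_inv SL2_det invr1. Qed.

Definition SL2_one := MkSL2 SL2_one_subproof.
Definition SL2_mul s t := MkSL2 (SL2_mul_subproof s t).
Definition SL2_inv s := MkSL2 (SL2_inv_subproof s).

Fact SL2_mulA : associative SL2_mul.
Proof. by move=> s t u; apply: val_inj; rewrite /= mulmxA. Qed.
Fact SL2_mul1 : left_id SL2_one SL2_mul.
Proof. by move=> s; apply: val_inj; rewrite /= mul1mx. Qed.
Fact SL2_mulr1 : right_id SL2_one SL2_mul.
Proof. by move=> s; apply: val_inj; rewrite /= mulmx1. Qed.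
Fact SL2_mulV : left_inverse SL2_one SL2_inv SL2_mul.
Proof. by move=> s; apply: val_inj; rewrite /= mulVmx ?SL2_unit. Qed.
Fact SL2_mulrV : right_inverse SL2_one SL2_inv SL2_mul.
Proof. by move=> s; apply: val_inj; rewrite /= mulmxV ?SL2_unit. Qed.

HB.instance Definition _ := isGroup.Build (SL2 K)
  SL2_mulA SL2_mul1 SL2_mulr1 SL2_mulV SL2_mulrV.

End SL2Group.

(* A morphism from SL_2 to a (possibly infinite-dimensional) K-space M is an
   element of K[SL_2] (x) M; here K[SL_2] consists of the polynomials in the
   four entries a, b, c, d (read off by mxvec) restricted to SL_2. *)
Definition regular_map (K : fieldType) (M : lmodType K) (g : SL2 K -> M) :=
  exists (r : nat) (p : 'I_r -> {mpoly K[2 * 2]}) (m : 'I_r -> M),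
    forall s, g s = \sum_(k < r) (p k).@[mxvec (s : 'M_2) 0] *: m k.

(* A finite-dimensional SL_2-module with linear algebraic action, in
   coordinates: s acts on column vectors by v |-> gm_rep s *m v, so that
   column j of gm_rep s holds the image of the j-th basis vector. *)
Record gmodule (K : fieldType) := GModule {
  gm_dim : nat;
  gm_rep :> SL2 K -> 'M[K]_gm_dim;
  _ : gm_rep 1%g = 1%:M;
  _ : forall s t, gm_rep (s * t)%g = gm_rep s *m gm_rep t;
  _ : regular_map gm_rep
}.

Section RegularMaps.
Variable K : fieldType.

Lemma regular_map_linear (M N : lmodType K) (h : {linear M -> N})
    (g : SL2 K -> M) :
  regular_map g -> regular_map (fun s => h (g s)).
Proof.
case=> r [p [m E]]; exists r, p, (fun k => h (m k)) => s.
by rewrite E linear_sum; apply: eq_bigr => k _; rewrite linearZ.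
Qed.

Lemma regular_mapD (M : lmodType K) (g h : SL2 K -> M) :
  regular_map g -> regular_map h -> regular_map (fun s => g s + h s).
Proof.
case=> r [p [m E]] [r' [p' [m' E']]].
exists (r + r')%N.
exists (fun k => match split k with inl i => p i | inr i => p' i end).
exists (fun k => match split k with inl i => m i | inr i => m' i end) => s.
rewrite E E' big_split_ord /=.
by congr (_ + _); apply: eq_bigr => k _;
  rewrite (unsplitK (inl k)) || rewrite (unsplitK (inr k)).
Qed.

Lemma regular_map_entries (n m : nat) (g : SL2 K -> 'M[K]_(n, m))
    (p : 'I_n -> 'I_m -> {mpoly K[2 * 2]}) :
  (forall s i j, g s i j = (p i j).@[mxvec (s : 'M_2) 0]) -> regular_map g.
Proof.
move=> E; exists #|{: 'I_n * 'I_m}|.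
exists (fun k => p (enum_val k).1 (enum_val k).2).
exists (fun k => delta_mx (enum_val k).1 (enum_val k).2) => s.
rewrite [LHS]matrix_sum_delta pair_big /= (reindex _ (onW_bij _ (enum_val_bij _))) /=.
by apply: eq_bigr => k _; rewrite E.
Qed.

Lemma regular_map_inv (M : lmodType K) (g : SL2 K -> M) :
  regular_map g -> regular_map (fun s => g s^-1%g).
Proof.
case=> r [p [m E]].
pose A : 'M[{mpoly K[2 * 2]}]_2 := \matrix_(i, j) 'X_(mxvec_index i j).
exists r, (fun k => p k \mPo [tuple mxvec (\adj A) 0 i | i < 2 * 2]), m => s.
rewrite E; apply: eq_bigr => k _; congr (_ *: _).
rewrite comp_mpoly_meval; apply: meval_eq => l.
rewrite tnth_mktuple; case/mxvec_indexP: l => i j.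
rewrite !mxvecE /= /invmx SL2_unit SL2_det invr1 scale1r.
have {1}-> : SL2val s = map_mx (meval (mxvec (SL2val s) 0)) A.
  by apply/matrixP=> i' j'; rewrite !mxE mevalXU mxvecE.
by rewrite -map_mx_adj mxE.
Qed.

End RegularMaps.

Section GModules.
Variable K : fieldType.
Implicit Types M N : gmodule K.

Lemma gm1 M : M 1%g = 1%:M.
Proof. by case: M. Qed.
Lemma gmM M s t : M (s * t)%g = M s *m M t.
Proof. by case: M. Qed.
Lemma gm_regular M : regular_map M.
Proof. by case: M. Qed.

Definition gm_iso M N :=
  exists (A : 'M[K]_(gm_dim N, gm_dim M)) (B : 'M[K]_(gm_dim M, gm_dim N)),
    [/\ A *m B = 1%:M, B *m A = 1%:M & forall s, A *m M s = N s *m A].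

Definition dsum_rep M N s := block_mx (M s) 0 0 (N s).
Fact dsum1 M N : dsum_rep M N 1%g = 1%:M.
Proof. by rewrite /dsum_rep !gm1 -scalar_mx_block. Qed.
Fact dsumM M N s t : dsum_rep M N (s * t)%g = dsum_rep M N s *m dsum_rep M N t.
Proof.
by rewrite /dsum_rep !gmM mulmx_block !(mulmx0, mul0mx, addr0, add0r).
Qed.
Fact dsum_regular M N : regular_map (dsum_rep M N).
Proof.
pose l (m n : nat) (A : 'M[K]_m) : 'M[K]_(m + n) := block_mx A 0 0 0.
pose r (m n : nat) (A : 'M[K]_n) : 'M[K]_(m + n) := block_mx 0 0 0 A.
have [rM [p [u E]]] := gm_regular M; have [rN [q [v F]]] := gm_regular N.
have lE m n k (w : 'I_k -> K) (A : 'I_k -> 'M[K]_m) :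
    l m n (\sum_i w i *: A i) = \sum_i w i *: l m n (A i).
  elim/big_rec2: _ => [|i ? B _ <-]; first by rewrite /l block_mx0.
  by rewrite /l scale_block_mx add_block_mx !scaler0 !addr0.
have rE m n k (w : 'I_k -> K) (A : 'I_k -> 'M[K]_n) :
    r m n (\sum_i w i *: A i) = \sum_i w i *: r m n (A i).
  elim/big_rec2: _ => [|i ? B _ <-]; first by rewrite /r block_mx0.
  by rewrite /r scale_block_mx add_block_mx !scaler0 !addr0.
have: regular_map (fun s => l _ (gm_dim N) (M s) + r (gm_dim M) _ (N s)).
  apply: regular_mapD.
    by exists rM, p, (fun k => l _ _ (u k)) => s; rewrite E lE.
  by exists rN, q, (fun k => r _ _ (v k)) => s; rewrite F rE.
case=> k [p' [m' H]]; exists k, p', m' => s; rewrite -H /l /r /dsum_rep.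
by rewrite add_block_mx !addr0 add0r.
Qed.
Definition dsum M N :=
  @GModule K _ _ (dsum1 M N) (dsumM M N) (dsum_regular M N).

(* The dual module, in the dual basis: (s phi)(v) = phi (s^-1 v). *)
Definition dual_rep M s := (M s^-1%g)^T.
Fact dual1 M : dual_rep M 1%g = 1%:M.
Proof. by rewrite /dual_rep invg1 gm1 trmx1. Qed.
Fact dualM M s t : dual_rep M (s * t)%g = dual_rep M s *m dual_rep M t.
Proof. by rewrite /dual_rep invgM gmM trmx_mul. Qed.
Fact dual_regular M : regular_map (dual_rep M).
Proof.
exact: (regular_map_linear (@trmx K _ _) (regular_map_inv (gm_regular M))).
Qed.
Definition dual M := @GModule K _ _ (dual1 M) (dualM M) (@dual_regular M).

Lemma dualK M s : dual (dual M) s = M s.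
Proof. by rewrite /= /dual_rep /= /dual_rep trmxK invgK. Qed.

(* <X, Y>: with basis (X, Y) and s = [a b; c d] the columns of s are
   s X = a X + c Y and s Y = b X + d Y. *)
Fact nat1 : SL2val (1%g : SL2 K) = 1%:M.
Proof. by []. Qed.
Fact natM (s t : SL2 K) : SL2val (s * t)%g = SL2val s *m SL2val t.
Proof. by []. Qed.
Fact nat_regular : regular_map (@SL2val K).
Proof.
apply: (@regular_map_entries _ _ _ _ (fun i j => 'X_(mxvec_index i j))).
by move=> s i j; rewrite mevalXU mxvecE.
Qed.
Definition nat_module := @GModule K _ _ nat1 natM nat_regular.

(* <X^2, Y^2>: squaring the entries is multiplicative in characteristic 2. *)
Definition sq_rep (s : SL2 K) : 'M[K]_2 := map_mx (fun x => x ^+ 2) s.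
Fact sq1 : sq_rep 1%g = 1%:M.
Proof. by apply/matrixP=> i j; rewrite !mxE; case: eqP; rewrite ?expr1n ?expr0n. Qed.
Fact sqM (hK : 2%N \in [pchar K]) s t : sq_rep (s * t)%g = sq_rep s *m sq_rep t.
Proof. exact: (map_mxM (pFrobenius_aut hK)). Qed.
Fact sq_regular : regular_map sq_rep.
Proof.
apply: (@regular_map_entries _ _ _ _ (fun i j => 'X_(mxvec_index i j) ^+ 2)).
by move=> s i j; rewrite rmorphXn /= mevalXU mxvecE mxE.
Qed.
Definition sq_module (hK : 2%N \in [pchar K]) :=
  @GModule K _ _ sq1 (sqM hK) sq_regular.

End GModules.

(* The symmetric algebra K[V] of V^* is {mpoly K[gm_dim V]}, variable j being
   the j-th vector of the dual basis; s acts by the algebra automorphism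
   extending its action on V^* . *)
Definition coord_act (K : fieldType) (V : gmodule K) (s : SL2 K)
    (f : {mpoly K[gm_dim V]}) : {mpoly K[gm_dim V]} :=
  f \mPo [tuple \sum_(i < gm_dim V) dual V s i j *: 'X_i | j < gm_dim V].

Definition invariant_ring (K : fieldType) (V : gmodule K)
    (f : {mpoly K[gm_dim V]}) : Prop :=
  forall s, coord_act s f = f.

Section Cohomology.
Variables (K : fieldType) (M : lmodType K) (act : SL2 K -> M -> M).

Definition cocycle (g : SL2 K -> M) :=
  regular_map g /\ forall s t, g (s * t)%g = act s (g t) + g s.

Definition coboundary (g : SL2 K -> M) := exists v, forall s, g s = act s v - v.

Definition nontrivial_in_H1 (g : SL2 K -> M) := cocycle g /\ ~ coboundary g.

End Cohomology.

Definition annihilates (K : fieldType) (V : gmodule K)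
    (f : {mpoly K[gm_dim V]}) (g : SL2 K -> {mpoly K[gm_dim V]}) :=
  invariant_ring f /\ coboundary (@coord_act K V) (fun s => f * g s).

(* Throughout, R is (the membership predicate of) a subalgebra of a polynomial
   ring, graded by total degree. *)
Section GradedSubalgebras.
Variables (K : fieldType) (n : nat) (R : {mpoly K[n]} -> Prop).
Implicit Types s b : seq {mpoly K[n]}.

Definition alg_independent s :=
  forall P : {mpoly K[size s]}, P \mPo in_tuple s = 0 -> P = 0.

(* The combination of the entries of b with coefficients c_i(s) in K[s]. *)
Definition subalg_comb s b (c : 'I_(size b) -> {mpoly K[size s]}) :=
  \sum_(i < size b) (c i \mPo in_tuple s) * b`_i.

Definition subalg_spans s b :=
  (forall f, f \in b -> R f) /\ forall f, R f -> exists c, f = @subalg_comb s b c.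

Definition hsop s :=
  [/\ forall f, f \in s -> R f /\ exists d : nat, f \is d.-homog,
      alg_independent s
    & exists b, subalg_spans s b].

Definition partial_hsop s := exists t, hsop (s ++ t).

Definition subalg_basis s b :=
  subalg_spans s b /\
  forall c, @subalg_comb s b c = 0 -> forall i : 'I_(size b), c i \mPo in_tuple s = 0.

(* Since R is finitely generated over K[s], a basis is necessarily finite. *)
Definition cohen_macaulay := exists s, hsop s /\ exists b, subalg_basis s b.

Definition in_ideal s (f : {mpoly K[n]}) :=
  exists c : 'I_(size s) -> {mpoly K[n]},
    (forall i, R (c i)) /\ f = \sum_(i < size s) c i * s`_i.

Definition regular_sequence s :=
  [/\ forall f, f \in s -> R f,
      ~ (forall h, R h -> in_ideal s h)
    & forall i, (i < size s)%N -> forall h, R h ->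
        in_ideal (take i s) (s`_i * h) -> in_ideal (take i s) h].

End GradedSubalgebras.

Section TheModule.
Variables (K : fieldType) (hK : 2%N \in [pchar K]).

Definition Vstar : gmodule K :=
  let N := nat_module K in dsum (sq_module hK) (dsum N (dsum N (dsum N N))).

(* By dualK, the dual of V is Vstar, in the same basis. *)
Definition V : gmodule K := dual Vstar.

(* The variables are ordered as X^2, Y^2, X_1, Y_1, ..., X_4, Y_4. *)
Definition Xsq : {mpoly K[gm_dim V]} := 'X_(inord 0 : 'I_10).
Definition Ysq : {mpoly K[gm_dim V]} := 'X_(inord 1 : 'I_10).
Definition X (i : nat) : {mpoly K[gm_dim V]} := 'X_(inord i.*2 : 'I_10).
Definition Y (i : nat) : {mpoly K[gm_dim V]} := 'X_(inord i.*2.+1 : 'I_10).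

Definition f_ (i j : nat) := X i * Y j + X j * Y i.

Definition in_sq_submodule (p : {mpoly K[gm_dim V]}) :=
  exists u v : K, p = u *: Xsq + v *: Ysq.

End TheModule.

(* Main.v *)
(** The cocycle g : s |-> s(XY) - XY = ab X^2 + cd Y^2 is killed by every f_ij, because
    (s - 1)(X^2 Y_i Y_j + Y^2 X_i X_j) = f_ij g_s.  If invariants a, b, c kill g, with
    (s - 1) v_a = a g_s and so on, then u = a v_b - b v_a is invariant and
    c u = a (c v_b - b v_c) + b (a v_c - c v_a) lies in (a, b); if u itself lies in (a, b) and
    a, b are coprime in K[V], then v_a can be corrected by an invariant to a multiple a w of a,
    whence g_s = (s - 1) w.  So no regular sequence of length 3 kills the nontrivial class of g
    (coprimality in K[V] is only needed for f_12 and f_23, where it is read off leading monomials).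

    That f_12, f_23, f_34 extend to an hsop theta of length 7: theta is algebraically independent by
    its leading monomials; the algebra B generated by the f_ij and g_i = X_i^2 Y^2 + Y_i^2 X^2 is
    finite over K[theta] by the Pluecker relations; every invariant lies in B[1/f_12] and B[1/f_34],
    hence in a finite K[theta]-module, and K[theta] is noetherian.

    If the invariant ring R were free over K[s] for some hsop s, consider J = Ann(g) in K[s].  Since
    R / Ann(g) is finite over the last four members of theta, K[s]/J has dimension at most 4, whereas
    s has at least 7 members; so J contains a regular sequence of length 3 of the polynomial ring
    K[s], which stays regular on the free module R. *)
Require Import Defs.
From HB Require Import structures.
From mathcomp Require Import all_boot all_order all_fingroup all_algebra.
From mathcomp Require Import mpoly ring zify.
From Stdlib Require Import Classical ClassicalEpsilon.
Set Implicit Arguments.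
Unset Strict Implicit.
Unset Printing Implicit Defensive.
Import Order.TTheory GRing.Theory.
Local Open Scope ring_scope.

(** * Finitely generated modules over polynomial rings *)

(** The lists supplied for the single entries are concatenated; monotonicity of [Q] keeps each
    property true in the longer list. *)
Lemma seq_fin_choice (A : eqType) (B : eqType) (s : seq A)
    (P : A -> B -> Prop) (Q : A -> seq B -> Prop) :
  (forall a, a \in s -> exists l, (forall b, b \in l -> P a b) /\ Q a l) ->
  (forall a l l', {subset l <= l'} -> Q a l -> Q a l') ->
  exists l, (forall b, b \in l -> exists2 a, a \in s & P a b) /\
            forall a, a \in s -> Q a l.
Proof.
move=> + mono; elim: s => [|a s IH] H; first by exists [::]; split.
have [|l [Pl Ql]] := IH; first by move=> b bs; apply: H; rewrite inE bs orbT.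
have [l' [Pl' Ql']] := H a (mem_head _ _).
exists (l' ++ l); split=> [b|b].
  rewrite mem_cat => /orP[/Pl' ?|/Pl [c cs ?]]; first by exists a; rewrite ?mem_head.
  by exists c => //; rewrite inE cs orbT.
rewrite inE => /predU1P[->|/Ql H']; first by apply: mono Ql' => x xl; rewrite mem_cat xl.
by apply: mono H' => x xl; rewrite mem_cat xl orbT.
Qed.

Lemma dickson (n : nat) (A : eqType) (mu : A -> 'I_n -> nat) (U : {set 'I_n})
    (L : A -> Prop) :
  exists l : seq A, (forall a, a \in l -> L a) /\
    forall a, L a -> exists2 b, b \in l & forall i, i \in U -> (mu b i <= mu a i)%N.
Proof.
elim: {U}#|U| {-2}U (erefl #|U|) L => [|k IH] U cU L.
  case: (classic (exists a, L a)) => [[a La]|nL]; last first.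
    by exists [::]; split=> // a La; case: nL; exists a.
  exists [:: a]; split=> [b|b Lb]; first by rewrite inE => /eqP->.
  exists a; first exact: mem_head.
  by move=> i; rewrite (cards0_eq cU) inE.
case: (classic (exists a, L a)) => [[a La]|nL]; last first.
  by exists [::]; split=> // a La; case: nL; exists a.
pose B := (\max_i mu a i)%N.
pose s := [seq (i, v) | i <- enum U, v <- iota 0 B].
pose P (iv : 'I_n * nat) b := L b /\ mu b iv.1 = iv.2.
pose Q (iv : 'I_n * nat) (l : seq A) := forall c, P iv c ->
  exists2 b, b \in l & forall i, i \in U -> (mu b i <= mu c i)%N.
have [iv ivs| |l [Pl Ql]] := @seq_fin_choice _ _ s P Q.
- have Ui : iv.1 \in U.
    by case/allpairsP: ivs => -[i v] /= [+ _ ->]; rewrite mem_enum.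
  have [|l [H1 H2]] := IH (U :\ iv.1) _ (P iv).
    by move: cU; rewrite (cardsD1 iv.1) Ui => -[].
  exists l; split=> // c Pc; have [b bl Hb] := H2 _ Pc; exists b => // i Ui'.
  case: (eqVneq i iv.1) => [->|ne]; last by apply: Hb; rewrite !inE ne.
  by rewrite (H1 _ bl).2 Pc.2.
- by move=> iv l l' sub H c /H [b bl Hb]; exists b => //; apply: sub.
exists (a :: l); split=> [b|c Lc].
  by rewrite inE => /predU1P[->//|/Pl [iv _ []]].
case: (boolP [forall i in U, mu a i <= mu c i]%N) => [/forall_inP H|].
  by exists a => //; rewrite mem_head.
case/forall_inPn => i Ui; rewrite -ltnNge => lt.
have ivs : (i, mu c i) \in s.
  apply/allpairsP; exists (i, mu c i); split=> //=; first by rewrite mem_enum.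
  rewrite mem_iota /=; apply: leq_trans lt _; exact: (leq_bigmax (F := mu a)).
have [b bl Hb] := Ql _ ivs c (conj Lc erefl).
by exists b => //; rewrite inE bl orbT.
Qed.

Section Span.
Variables (S T : comNzRingType) (phi : {rmorphism S -> T}).
Implicit Types (e : seq T) (f g x : T).

(** The [S]-submodule of [T] spanned by [e], scalars acting through [phi]; for [phi = idfun] it is
    the ideal generated by [e]. Peeling off one generator at a time suits induction on [e]; [gspanP]
    recovers the indexed sum. *)
Fixpoint gspan e f : Prop :=
  if e is x :: e' then exists c, gspan e' (f - phi c * x) else f = 0.

Lemma gspan0 e : gspan e 0.
Proof. by elim: e => //= x e IH; exists 0; rewrite rmorph0 mul0r subr0. Qed.

Lemma gspanD e f g : gspan e f -> gspan e g -> gspan e (f + g).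
Proof.
elim: e f g => /= [f g -> ->|x e IH f g [c Hc] [d Hd]]; first exact: addr0.
by exists (c + d); rewrite rmorphD mulrDl opprD addrACA; apply: IH.
Qed.

Lemma gspanM e f a : gspan e f -> gspan e (phi a * f).
Proof.
elim: e f => /= [f ->|x e IH f [c Hc]]; first by rewrite mulr0.
by exists (a * c); rewrite rmorphM -mulrA -mulrBr; apply: IH.
Qed.

Lemma gspanN e f : gspan e f -> gspan e (- f).
Proof. by move/(gspanM (-1)); rewrite rmorphN rmorph1 mulN1r. Qed.

Lemma gspan_sum e (J : Type) (r : seq J) (P : pred J) (F : J -> T) :
  (forall j, P j -> gspan e (F j)) -> gspan e (\sum_(j <- r | P j) F j).
Proof. by move=> H; elim/big_rec: _ => [|j y Pj]; [exact: gspan0|apply: gspanD; apply: H]. Qed.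

Lemma gspan_mem e f : f \in e -> gspan e f.
Proof.
elim: e => //= x e IH; rewrite inE => /predU1P[->|/IH H].
  by exists 1; rewrite rmorph1 mul1r subrr; apply: gspan0.
by exists 0; rewrite rmorph0 mul0r subr0.
Qed.

Lemma gspan_ind e (P : T -> Prop) : P 0 -> (forall f g, P f -> P g -> P (f + g)) ->
  (forall a f, f \in e -> P (phi a * f)) -> forall f, gspan e f -> P f.
Proof.
move=> P0 PD; elim: e => /= [_ f ->//|x e IH PM f [c /IH H]].
rewrite -(subrK (phi c * x) f); apply: PD; last by apply: PM; rewrite mem_head.
by apply: H => a g ge; apply: PM; rewrite inE ge orbT.
Qed.

Lemma gspanP e f :
  gspan e f <-> exists c : 'I_(size e) -> S, f = \sum_(i < size e) phi (c i) * e`_i.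
Proof.
split; last first.
  by case=> c ->; apply: gspan_sum => i _; apply/gspanM/gspan_mem/mem_nth.
elim: e f => /= [f ->|x e IH f [c /IH [d E]]].
  by exists (fun _ => 0); rewrite big_ord0.
exists (fun i => if unlift ord0 i is Some j then d j else c).
rewrite big_ord_recl unlift_none /= -(subrK (phi c * x) f) E addrC.
by congr (_ + _); apply: eq_bigr => i _; rewrite liftK.
Qed.

Definition submod (M : T -> Prop) :=
  [/\ M 0, forall f g, M f -> M g -> M (f + g) & forall a f, M f -> M (phi a * f)].

Lemma submod_gspan e : submod (gspan e).
Proof. by split; [exact: gspan0|exact: gspanD|move=> a f; exact: gspanM]. Qed.

Lemma sub_gspan e (M : T -> Prop) : submod M -> (forall x, x \in e -> M x) ->
  forall f, gspan e f -> M f.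
Proof. by case=> M0 MD MM H; apply: gspan_ind => // a f /H /MM. Qed.

End Span.

Definition noetherian (S : comNzRingType) := forall I : S -> Prop,
  submod idfun I ->
  exists e, (forall x, x \in e -> I x) /\ forall f, I f -> gspan idfun e f.

(** One step of the division algorithm. Exact divisibility is a separate case, because the leading
    monomial of [0] is [0] and need not be smaller than that of [f]. *)
Lemma lead_cancel (K : fieldType) (n : nat) (f g : {mpoly K[n]}) : g != 0 ->
  (mlead g <= mlead f)%MM ->
  exists X, f = X * g \/ (mlead (f - X * g) < mlead f)%O.
Proof.
move=> ng lgf; case: (eqVneq f 0) => [->|nf]; first by exists 0; left; rewrite mul0r.
pose c := mleadc f / mleadc g.
have cn : c != 0 by rewrite mulf_neq0 ?invr_eq0 ?mleadc_eq0.
pose X := c *: 'X_[K, mlead f - mlead g]; pose h := X * g.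
have lX : mlead X = (mlead f - mlead g)%MM by rewrite mleadZ ?mleadXm.
have cX : mleadc X = c by rewrite lX mcoeffZ mcoeffX eqxx mulr1.
have Xn : X != 0 by rewrite -mleadc_eq0 cX.
have lh : mlead h = mlead f by rewrite mleadM // lX submK.
have ch : mleadc h = mleadc f.
  by rewrite {2}/h mleadM // mleadcM cX divfK ?mleadc_eq0.
exists X; rewrite -/h; case: (eqVneq (f - h) 0) => [/eqP|nfh].
  by rewrite subr_eq0 => /eqP; left.
right; rewrite lt_neqAle; apply/andP; split.
  apply/eqP=> E; move: nfh; rewrite -mleadc_eq0 E mcoeffB -{2}lh ch.
  by rewrite subrr eqxx.
by apply: le_trans (mleadB_le _ _) _; rewrite lh joinxx.
Qed.

(** Hilbert's basis theorem through a Groebner basis: Dickson's lemma selects finitely many elements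
    of [I] whose leading monomials divide all others, and division by them terminates. *)
Lemma mpoly_noetherian (K : fieldType) (n : nat) : noetherian {mpoly K[n]}.
Proof.
move=> I [I0 ID IM].
have [e [He1 He2]] := @dickson n _ (fun p : {mpoly K[n]} => mlead p) setT
  (fun p => I p /\ p != 0).
exists e; split=> [x /He1[]//|f].
elim/mleadrect: f => f IH If; case: (eqVneq f 0) => [->|nf]; first exact: gspan0.
have [g ge Hg] := He2 f (conj If nf).
have [Ig ng] := He1 g ge.
have lgf : (mlead g <= mlead f)%MM by apply/mnm_lepP => i; apply: Hg.
have [X [->|lt]] := lead_cancel ng lgf; first exact/(gspanM (phi := idfun))/gspan_mem.
rewrite -(subrK (X * g) f); apply: gspanD; last exact/(gspanM (phi := idfun))/gspan_mem.
by apply: IH => //; apply: ID => //; rewrite -mulNr; apply: IM.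
Qed.

Lemma noetherian_submod_fg (S T : comNzRingType) (phi : {rmorphism S -> T})
    (e : seq T) (M : T -> Prop) :
  noetherian S -> submod phi M -> (forall f, M f -> gspan phi e f) ->
  exists b, (forall x, x \in b -> M x) /\ forall f, M f -> gspan phi b f.
Proof.
move=> nS; elim: e M => [|x e IH] M sM sub; first by exists [::].
have [M0 MD MM] := sM.
(* The ideal of coefficients that [x] can have in elements of [M]. Finitely many lifts of its
   generators, together with generators of the part of [M] inside the span of [e], will generate
   [M]. *)
pose I s := exists2 m, M m & gspan phi e (m - phi s * x).
have SI : submod idfun I.
  split.
  - by exists 0 => //; rewrite rmorph0 mul0r subr0; apply: gspan0.
  - move=> s t [m Mm Hm] [p Mp Hp]; exists (m + p); first exact: MD.
    by rewrite rmorphD mulrDl opprD addrACA; apply: gspanD.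
  - move=> a s [m Mm Hm]; exists (phi a * m); first exact: MM.
    by rewrite rmorphM /= -mulrA -mulrBr; apply: gspanM.
have [g [Hg1 Hg2]] := nS I SI.
have [|b [Hb1 Hb2]] := IH (fun f => M f /\ gspan phi e f) _ (fun f H => H.2).
  split; first by split=> //; apply: gspan0.
  - by move=> f h [? ?] [? ?]; split; [exact: MD|exact: gspanD].
  - by move=> a h [? ?]; split; [exact: MM|exact: gspanM].
have [l [Hl1 Hl2]] : exists l : seq T, (forall m, m \in l -> M m) /\
    forall s, s \in g -> exists2 m, m \in l & gspan phi e (m - phi s * x).
  have [s sg| |l [H1 H2]] := @seq_fin_choice _ _ g (fun s m => M m /\ gspan phi e (m - phi s * x))
     (fun s (l : seq T) => exists2 m, m \in l & gspan phi e (m - phi s * x)).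
  - have [m Mm Hm] := Hg1 _ sg; exists [:: m]; split=> [p|].
      by rewrite inE => /eqP->.
    by exists m; rewrite ?mem_head.
  - by move=> a l l' sl [m /sl ? ?]; exists m.
  by exists l; split=> // m /H1 [? _ []].
exists (l ++ b); split=> [y|f Mf].
  by rewrite mem_cat => /orP[/Hl1|/Hb1 []].
have spl h : gspan phi l h -> gspan phi (l ++ b) h.
  by apply: sub_gspan; [exact: submod_gspan|move=> y yl; apply/gspan_mem; rewrite mem_cat yl].
have spb h : gspan phi b h -> gspan phi (l ++ b) h.
  by apply: sub_gspan; [exact: submod_gspan|move=> y yl; apply/gspan_mem; rewrite mem_cat yl orbT].
have /= [c Hc] := sub f Mf.
have Ic : I c by exists f.
have [m lm Hm] : exists2 m, gspan phi l m & gspan phi e (m - phi c * x).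
  pose Q c := exists2 m, gspan phi l m & gspan phi e (m - phi c * x).
  apply: (gspan_ind (P := Q)) (Hg2 c Ic) => [|s t [m ? ?] [p ? ?]|a s /Hl2 [m' ml Hm]].
  - by exists 0; [exact: gspan0|rewrite rmorph0 mul0r subr0; apply: gspan0].
  - exists (m + p); first exact: gspanD.
    by rewrite rmorphD mulrDl opprD addrACA; apply: gspanD.
  - exists (phi a * m'); first by apply/gspanM/gspan_mem.
    by rewrite rmorphM /= -mulrA -mulrBr; apply: gspanM.
rewrite -(subrK m f); apply: gspanD; last exact: spl.
apply/spb/Hb2; split.
  by apply: MD => //; rewrite -mulN1r -(rmorphN1 phi); exact: (MM _ _ (sub_gspan sM Hl1 lm)).
suff -> : f - m = f - phi c * x - (m - phi c * x) by apply: gspanD => //; apply: gspanN.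
by ring.
Qed.

(** * Coprimality and algebraic independence read off leading monomials *)

(** Comparing leading monomials in [f * B = g * A], that of [f] divides that of [A]. Replacing [A]
    by [A - X * f] and [B] by [B - X * g] preserves the equation and lowers [A]. *)
Lemma coprime_lead_dvd (K : fieldType) (n : nat) (f g A B : {mpoly K[n]}) :
  f != 0 -> g != 0 ->
  (forall i, mlead f i = 0%N \/ mlead g i = 0%N) ->
  f * B = g * A -> exists w, A = f * w.
Proof.
move=> nf ng cop; elim/mleadrect: A B => A IH B E.
case: (eqVneq A 0) => [->|nA]; first by exists 0; rewrite mulr0.
have nB : B != 0.
  by apply/eqP=> B0; move: E; rewrite B0 mulr0 => /esym/eqP; rewrite mulf_eq0 (negPf ng) (negPf nA).
have lE : (mlead f + mlead B = mlead g + mlead A)%MM by rewrite -!mleadM // E.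
have lfA : (mlead f <= mlead A)%MM.
  apply/mnm_lepP=> i; have /mnmP/(_ i) := lE; rewrite !mnmDE.
  by case: (cop i) => ->; lia.
have [X [->|lt]] := lead_cancel nf lfA; first by exists X; rewrite mulrC.
have [|w Ew] := IH _ lt (B - X * g); first by rewrite !mulrBr E; ring.
by exists (w + X); rewrite mulrDr -Ew; ring.
Qed.

Lemma seq_argmax d (O : orderType d) (A : eqType) (g : A -> O) (l : seq A) :
  l != [::] -> exists2 a, a \in l & forall b, b \in l -> (g b <= g a)%O.
Proof.
elim: l => // a l IH _; case: (eqVneq l [::]) => [->|/IH [b bl H]].
  by exists a; rewrite ?mem_head // => b; rewrite inE => /eqP->.
case: (leP (g a) (g b)) => lab.
  by exists b; rewrite ?inE ?bl ?orbT // => x; rewrite inE => /predU1P[->//|/H].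
exists a; first exact: mem_head.
by move=> x; rewrite inE => /predU1P[->//|/H /le_trans]; apply; apply: ltW.
Qed.

(** By injectivity of the exponent map, distinct monomials in [s] have distinct leading monomials,
    so the largest one occurring in [P] cannot cancel. *)
Lemma lead_alg_independent (K : fieldType) (n : nat) (s : seq {mpoly K[n]}) :
  (forall f, f \in s -> f != 0) ->
  (forall m m' : 'X_{1..size s},
     (\sum_(i < size s) mlead s`_i *+ m i = \sum_(i < size s) mlead s`_i *+ m' i)%MM ->
     m = m') ->
  alg_independent s.
Proof.
move=> ns inj P.
have [F FE] : exists F, forall m, F m = P@_m *: ('X_[m] \mPo in_tuple s).
  by exists (fun m => P@_m *: ('X_[m] \mPo in_tuple s)).
have E : P \mPo in_tuple s = \sum_(m <- msupp P) F m.
  rewrite {1}(mpolyE P) linear_sum; apply: eq_bigr => m _.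
  by rewrite linearZ FE.
have lF m : m \in msupp P ->
    F m != 0 /\ mlead (F m) = (\sum_(i < size s) mlead s`_i *+ m i)%MM.
  rewrite mcoeff_msupp => cm; rewrite FE comp_mpolyX.
  have nz i : tnth (in_tuple s) i != 0 by apply/ns/mem_tnth.
  have nzp i : tnth (in_tuple s) i ^+ m i != 0 by rewrite expf_neq0.
  split; first by rewrite scaler_eq0 negb_or cm; apply/prodf_neq0 => i _.
  rewrite mleadZ // mlead_prod //; apply: eq_bigr => i _.
  by rewrite mleadX // (tnth_nth 0).
case: (eqVneq P 0) => // nP P0; exfalso.
have [|m0 m0P Hmax] := @seq_argmax _ _ _ (fun m => mlead (F m)) (msupp P).
  by rewrite msupp_eq0.
have: (P \mPo in_tuple s)@_(mlead (F m0)) = 0 by rewrite P0 mcoeff0.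
rewrite E (bigD1_seq m0) ?msupp_uniq //= mcoeffD raddf_sum /= big_seq_cond big1 => [|m /andP[mP nm]].
  by rewrite addr0 => /eqP; rewrite mleadc_eq0 (negPf (lF _ m0P).1).
apply: mcoeff_gt_mlead; rewrite lt_neqAle Hmax // andbT.
apply: contra nm => /eqP; rewrite (lF _ mP).2 (lF _ m0P).2 => /inj->.
exact: eqxx.
Qed.

Lemma mpoly_rmorph_ext (K : fieldType) (n : nat) (T : nzRingType)
    (h1 h2 : {rmorphism {mpoly K[n]} -> T}) :
  (forall c, h1 c%:MP = h2 c%:MP) -> (forall i, h1 'X_i = h2 'X_i) -> h1 =1 h2.
Proof.
move=> hC hX p; rewrite (mpolyE p) !rmorph_sum; apply: eq_bigr => m _.
rewrite -mul_mpolyC !rmorphM hC mpolyXE_id !rmorph_prod; congr (_ * _).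
by apply: eq_bigr => i _; rewrite !rmorphXn hX.
Qed.

(** * Linear changes of variables *)

(* The substitution X_i -> X_i + c_i X_n (i < n), X_n -> c_n X_n, with the last variable singled out. *)
Section LinearChange.
Variables (K : fieldType) (n : nat) (c : 'I_n.+1 -> K).

Definition to_uni : {mpoly K[n.+1]} -> {poly {mpoly K[n]}} :=
  mmap (polyC \o @mpolyC n K)
    (fun i => (if unlift ord_max i is Some j then ('X_j)%:P else 0) + (c i)%:MP *: 'X).
HB.instance Definition _ := GRing.RMorphism.on to_uni.

Definition of_uni_coef : {mpoly K[n]} -> {mpoly K[n.+1]} :=
  comp_mpoly [tuple 'X_(lift ord_max j) - (c (lift ord_max j) / c ord_max) *: 'X_ord_max | j < n].
HB.instance Definition _ := GRing.RMorphism.on of_uni_coef.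

Definition of_uni : {poly {mpoly K[n]}} -> {mpoly K[n.+1]} :=
  horner_eval ((c ord_max)^-1 *: 'X_ord_max) \o map_poly of_uni_coef.
HB.instance Definition _ := GRing.RMorphism.on of_uni.

Lemma to_uniC a : to_uni a%:MP = a%:MP%:P.
Proof. exact: mmapC. Qed.

Lemma to_uniX i : to_uni 'X_i =
  (if unlift ord_max i is Some j then ('X_j)%:P else 0) + (c i)%:MP *: 'X.
Proof. by rewrite /to_uni mmapX mmap1U. Qed.

Lemma of_uniC q : of_uni q%:P = of_uni_coef q.
Proof. by rewrite /of_uni /= /horner_eval map_polyC hornerC. Qed.

Lemma of_uniX : of_uni 'X = (c ord_max)^-1 *: 'X_ord_max.
Proof. by rewrite /of_uni /= /horner_eval map_polyX hornerX. Qed.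

Hypothesis cn : c ord_max != 0.

Lemma to_uniK : cancel to_uni of_uni.
Proof.
apply: (mpoly_rmorph_ext (h1 := of_uni \o to_uni) (h2 := idfun)) => [a|i] /=.
  by rewrite to_uniC of_uniC /of_uni_coef comp_mpolyC.
rewrite to_uniX rmorphD -mul_polyC rmorphM /= of_uniC of_uniX /of_uni_coef comp_mpolyC mul_mpolyC.
case: unliftP => [j ->|->].
  rewrite of_uniC /of_uni_coef comp_mpolyXU -tnth_nth tnth_mktuple.
  by rewrite scalerA subrK.
by rewrite rmorph0 add0r scalerA divff ?scale1r.
Qed.

Lemma of_uniK : cancel of_uni to_uni.
Proof.
move=> p; have HX : to_uni (of_uni 'X) = 'X.
  rewrite of_uniX -mul_mpolyC rmorphM /= to_uniC to_uniX unlift_none add0r mul_polyC.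
  by rewrite scalerA -rmorphM /= mulVf ?scale1r.
have HC q : to_uni (of_uni q%:P) = q%:P.
  rewrite of_uniC.
  apply: (mpoly_rmorph_ext (h1 := to_uni \o of_uni_coef) (h2 := polyC)) => [a|j] /=.
    by rewrite /of_uni_coef comp_mpolyC to_uniC.
  rewrite /of_uni_coef comp_mpolyXU -tnth_nth tnth_mktuple rmorphB /= to_uniX liftK.
  rewrite -mul_mpolyC rmorphM /= to_uniC to_uniX unlift_none add0r mul_polyC.
  by rewrite scalerA -rmorphM /= divfK // addrK.
elim/poly_ind: p => [|p a IH]; first by rewrite !rmorph0.
by rewrite !rmorphD !rmorphM /= IH HX HC.
Qed.

End LinearChange.

(** Induction on the number of variables: first a point where the leading coefficient in the last
    variable survives, then a non-root of the resulting univariate polynomial. *)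
Lemma mpoly_nonvanishing (K : closedFieldType) (n : nat) (f : {mpoly K[n]}) :
  f != 0 -> exists v : 'I_n -> K, f.@[v] != 0.
Proof.
elim: n f => [|n IH] f nf.
  exists (fun _ => 0); move: nf; rewrite (nvar0_mpolyC f) mevalC.
  by apply: contra => /eqP->.
(* With this [c] the change of variables is the identity, and [to_uni] only singles out the last
   variable. *)
pose c (i : 'I_n.+1) : K := (i == ord_max)%:R.
have cn : c ord_max != 0 by rewrite /c eqxx oner_eq0.
have /IH [v Hv] : lead_coef (to_uni c f) != 0.
  rewrite lead_coef_eq0; apply: contra nf => /eqP E.
  by rewrite -(to_uniK cn f) E rmorph0.
have /closed_nonrootP [t Ht] : map_poly (meval v) (to_uni c f) != 0.
  apply: contra Hv => /eqP/polyP/(_ (size (to_uni c f)).-1).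
  by rewrite coef_map coef0 /= => ->.
exists (fun i => if unlift ord_max i is Some j then v j else t).
move: Ht; rewrite /root; congr (_ != 0).
apply: (mpoly_rmorph_ext (h1 := horner_eval t \o map_poly (meval v) \o to_uni c)
  (h2 := meval (fun i => if unlift ord_max i is Some j then v j else t))) => [a|i] /=.
  by rewrite to_uniC map_polyC /horner_eval hornerC /= !mevalC.
rewrite to_uniX mevalXU rmorphD /= linearZ /= map_polyX mevalC /horner_eval /c.
case: unliftP => [j ->|->].
  rewrite map_polyC /= mevalXU hornerD hornerC hornerZ.
  by rewrite eq_sym (negPf (neq_lift _ _)) mul0r addr0.
by rewrite map_poly0 add0r eqxx scale1r hornerX.
Qed.

(** * Algebraic dependence modulo an ideal *)

Lemma exists_left_kernel (K : fieldType) (A B : finType) (M : A -> B -> K) :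
  (#|B| < #|A|)%N ->
  exists2 v : A -> K, (exists a, v a != 0) & forall b, \sum_a v a * M a b = 0.
Proof.
move=> lt; pose W := \matrix_(i < #|A|, j < #|B|) M (enum_val i) (enum_val j).
have : kermx W != 0.
  rewrite -mxrank_eq0 mxrank_ker subn_eq0 -ltnNge.
  exact: leq_ltn_trans (rank_leq_col _) lt.
case/rowV0Pn => v /sub_kermxP vW nv.
exists (fun a => v 0 (enum_rank a)).
  case: (pickP (fun j => v 0 j != 0)) => [j nj|v0].
    by exists (enum_val j); rewrite enum_valK.
  by case/eqP: nv; apply/rowP=> j; rewrite mxE; apply/eqP/negbFE/v0.
move=> b; have /rowP/(_ (enum_rank b)) := vW; rewrite !mxE => E; rewrite -[RHS]E.
rewrite [LHS](reindex _ (onW_bij _ (enum_val_bij _))) /=.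
by apply: eq_bigr => i _; rewrite mxE enum_valK enum_rankK.
Qed.

(** Since [m L + 1 <= (m + 1) L], the left side is at most [C L^r] with [C = s (e (m + 1))^r]; hence
    [L = C + 1] works. *)
Lemma growth_bound (s e r m : nat) : (r < m)%N ->
  exists L, (s * (e * (m * L).+1) ^ r < L ^ m)%N.
Proof.
move=> rm; pose L := (s * (e * m.+1) ^ r).+1; exists L.
have le : ((e * (m * L).+1) ^ r <= (e * m.+1) ^ r * L ^ r)%N.
  rewrite -expnMn; case: r {rm} @L => // r L; rewrite leq_exp2r // -mulnA leq_mul2l.
  by rewrite /L; nia.
apply: (@leq_trans (L ^ r.+1)); last by rewrite leq_pexp2l.
apply: (@leq_ltn_trans (s * (e * m.+1) ^ r * L ^ r)); first by rewrite -mulnA leq_mul2l le orbT.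
by rewrite expnS ltn_mul2r expn_gt0 /= ltnSn.
Qed.

Section Dependence.
Variables (K : fieldType) (N r : nat) (R I : {mpoly K[N]} -> Prop).
Variables (z : r.-tuple {mpoly K[N]}) (b : seq {mpoly K[N]}).
Hypothesis I0 : I 0.
Hypothesis ID : forall f g, I f -> I g -> I (f + g).
Hypothesis IM : forall f g, R f -> I g -> I (f * g).
Hypothesis RC : forall c, R c%:MP.
Hypothesis RM : forall f g, R f -> R g -> R (f * g).
Hypothesis Rb : forall f, f \in b -> R f.
Hypothesis Rz : forall i, R (tnth z i).
Hypothesis RD : forall f g, R f -> R g -> R (f + g).
Hypothesis gen : forall f, R f -> exists2 g, gspan (comp_mpoly z) b g & I (f - g).

Let phi : {rmorphism {mpoly K[r]} -> {mpoly K[N]}} := comp_mpoly z.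

Let Rphi P : R (phi P).
Proof.
rewrite /phi /= comp_mpolyEX; elim/big_rec: _ => [|m y _ Ry]; first exact: (RC 0).
apply: RD => //; rewrite -mul_mpolyC; apply: RM => //; rewrite comp_mpolyX.
elim/big_rec: _ => [|i w _ Rw]; first exact: (RC 1).
apply: RM => //; elim: (m i) => [|k IH]; first exact: (RC 1).
by rewrite exprS; apply: RM.
Qed.

(* Filtration of R by the degrees of the coefficients needed on the generators b, modulo I. *)
Let D w f := exists2 c : 'I_(size b) -> {mpoly K[r]}, (forall k, msize (c k) <= w)%N &
  I (f - \sum_(k < size b) phi (c k) * b`_k).

Let exists_D f : R f -> exists w, D w f.
Proof.
move=> /gen [g /gspanP[c ->] If]; exists (\max_k msize (c k)); exists c => // k.
exact: leq_bigmax.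
Qed.

Let D_le w w' f : (w <= w')%N -> D w f -> D w' f.
Proof. by move=> le [c H1 H2]; exists c => // k; apply: leq_trans le. Qed.

Let D0 w : D w 0.
Proof.
exists (fun _ => 0) => [k|]; first by rewrite mmeasure0.
by rewrite big1 ?subr0 // => k _; rewrite rmorph0 mul0r.
Qed.

Let DD w f g : D w f -> D w g -> D w (f + g).
Proof.
move=> [c c1 c2] [d d1 d2]; exists (fun k => c k + d k) => [k|].
  by apply: leq_trans (msizeD_le _ _) _; rewrite geq_max c1 d1.
have := ID c2 d2; congr I; rewrite addrACA -opprD -big_split /=; congr (_ - _).
by apply: eq_bigr => k _; rewrite rmorphD mulrDl.
Qed.

Let DI w f g : I (f - g) -> D w g -> D w f.
Proof. by move=> Ifg [c c1 c2]; exists c => //; rewrite -(subrK g f) -addrA; apply: ID. Qed.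

Let DM w w' f p : (msize p <= w')%N -> D w f -> D (w' + w) (phi p * f).
Proof.
move=> lp [c c1 c2]; exists (fun k => p * c k) => [k|].
  case: (eqVneq p 0) => [->|np]; first by rewrite mul0r mmeasure0.
  case: (eqVneq (c k) 0) => [->|nc]; first by rewrite mulr0 mmeasure0.
  rewrite msizeM //; apply: leq_trans (leq_pred _) _; exact: leq_add.
rewrite (_ : _ - _ = phi p * (f - \sum_(k < size b) phi (c k) * b`_k)); first exact: IM.
rewrite mulrBr mulr_sumr; congr (_ - _); apply: eq_bigr => k _.
by rewrite rmorphM /= mulrA.
Qed.

Let bound_D (A : finType) (F : A -> {mpoly K[N]}) : (forall a, R (F a)) ->
  exists w, forall a, D w (F a).
Proof.
move=> RF.
have H a : exists w, D w (F a) by apply: exists_D.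
suff [w Hw] : exists w, forall a, a \in enum A -> D w (F a).
  by exists w => a; apply: Hw; rewrite mem_enum.
elim: (enum A) => [|a l [w Hw]]; first by exists 0%N.
have [w' Hw'] := H a; exists (maxn w w') => c; rewrite inE => /predU1P[->|/Hw].
  by apply: D_le Hw'; apply: leq_maxr.
by apply: D_le; apply: leq_maxl.
Qed.

(* The monomials of degree at most N in m elements are about N^m in number, but they lie in a
   space of dimension O(N^r). *)
Lemma dependent_mod (m : nat) (x : m.-tuple {mpoly K[N]}) : (r < m)%N ->
  (forall i, R (tnth x i)) -> exists2 P : {mpoly K[m]}, P != 0 & I (P \mPo x).
Proof.
move=> rm Rx.
have [e1 He1] := @bound_D unit (fun _ => 1) (fun _ => RC 1).
have [e2 He2] := @bound_D _ (fun ik : 'I_m * 'I_(size b) => tnth x ik.1 * b`_ik.2)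
  (fun ik => RM (Rx ik.1) (Rb (mem_nth 0 (ltn_ord ik.2)))).
(* One constant for [1] and for all products of some [x_i] with a generator: each further factor
   [x_i] then raises the filtration level by at most [e]. *)
pose e := maxn e1 e2.
have Dx w i f : D w f -> D (e + w) (tnth x i * f).
  move=> [c c1 c2]; apply: (@DI _ _ (tnth x i * \sum_(k < size b) phi (c k) * b`_k)).
    by rewrite -mulrBr; apply: IM.
  rewrite mulr_sumr; elim/big_rec: _ => [|k y _ Dy]; first exact: D0.
  apply: DD => //; rewrite mulrCA addnC; apply: DM => //.
  exact: D_le (leq_maxr _ _) (He2 (i, k)).
have DX (a : 'X_{1..m}) : D (e * (mdeg a).+1) ('X_[a] \mPo x).
  have [k] := ubnP (mdeg a); elim: k a => // k IH a lt.
  case: (eqVneq a 0%MM) => [->|]; first rewrite mpolyX0 mdeg0 muln1 rmorph1.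
    exact: D_le (leq_maxl _ _) (He1 tt).
  case: (pickP (fun i => a i != 0%N)) => [i ai|a0 /eqP[]]; last first.
    by apply/mnmP=> i; rewrite mnm0E; apply/eqP/negbFE/a0.
  move=> _; have ia : (U_(i) <= a)%MM by rewrite lep1mP.
  move: lt; rewrite -(submK ia) mdegD mdeg1 addn1 => lt.
  rewrite addmC mpolyXD rmorphM /= comp_mpolyXU -tnth_nth mulnS.
  by apply: Dx; apply: IH.
have [L HL] := @growth_bound (size b) e r m rm.
pose w := (e * (m * L).+1)%N.
pose mn (a : {ffun 'I_m -> 'I_L}) : 'X_{1..m} := [multinom nat_of_ord (a i) | i < m].
have mnw a : (e * (mdeg (mn a)).+1 <= w)%N.
  rewrite leq_mul2l ltnS mdegE; apply/orP; right.
  apply: (@leq_trans (\sum_(i < m) L)); last by rewrite sum_nat_const card_ord.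
  by apply: leq_sum => i _; rewrite mnmE ltnW.
have [c Hc] : exists c : {ffun 'I_m -> 'I_L} -> 'I_(size b) -> {mpoly K[r]}, forall a,
   (forall k, msize (c a k) <= w)%N /\
   I ('X_[mn a] \mPo x - \sum_(k < size b) phi (c a k) * b`_k).
  have H a : exists c : 'I_(size b) -> {mpoly K[r]}, (forall k, msize (c k) <= w)%N /\
   I ('X_[mn a] \mPo x - \sum_(k < size b) phi (c k) * b`_k).
    by have [c c1 c2] := D_le (mnw a) (DX (mn a)); exists c.
  exists (fun a => sval (constructive_indefinite_description _ (H a))) => a.
  by case: constructive_indefinite_description.
(* Rows are the monomials with exponents below [L]; columns are pairs of a generator and an exponent
   vector below [w]. By [growth_bound] there are more rows than columns, and a left kernel vector
   supplies the coefficients of [P]. *)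
pose co (a : {ffun 'I_m -> 'I_L}) (kt : 'I_(size b) * {ffun 'I_r -> 'I_w}) :=
  (c a kt.1)@_[multinom nat_of_ord (kt.2 i) | i < r].
have [|v [a0 va0] Hv] := @exists_left_kernel _ _ _ co.
  by rewrite card_prod !card_ffun !card_ord.
have mn_inj : injective mn.
  by move=> a a' /mnmP E; apply/ffunP=> i; apply: val_inj; have := E i; rewrite !mnmE.
exists (\sum_a v a *: 'X_[mn a]).
  apply/eqP=> /(congr1 (mcoeff (mn a0))); rewrite mcoeff0 raddf_sum /= (bigD1 a0) //=.
  rewrite big1 => [|a na]; rewrite mcoeffZ mcoeffX.
    by rewrite eqxx mulr1 addr0 => /eqP; rewrite (negPf va0).
  by rewrite (inj_eq mn_inj) (negPf na) mulr0.
have E k : \sum_a v a *: c a k = 0.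
  apply/mpolyP=> t; rewrite mcoeff0 raddf_sum /=.
  case: (boolP [forall i, t i < w]%N) => [/forallP tw|/forallPn [i iw]].
    rewrite -[RHS](Hv (k, [ffun i => Ordinal (tw i)])); apply: eq_bigr => a _.
    rewrite mcoeffZ /co /=; congr (_ * _@__); apply/mnmP=> i.
    by rewrite mnmE ffunE.
  (* Exponent vectors outside the box contribute nothing, because [msize] at most [w] forces every
     exponent below [w]. *)
  rewrite big1 // => a _; rewrite mcoeffZ memN_msupp_eq0 ?mulr0 //.
  apply: msize_mdeg_ge; apply: leq_trans ((Hc a).1 k) _; rewrite -leqNgt in iw.
  by apply: leq_trans iw _; rewrite mdegE (bigD1 i) //= leq_addr.
rewrite raddf_sum /=.
have -> : \sum_a ((v a *: 'X_[mn a]) \mPo x) =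
   \sum_a (v a)%:MP * ('X_[mn a] \mPo x - \sum_(k < size b) phi (c a k) * b`_k).
  rewrite -[LHS]subr0 -[X in _ - X](_ : \sum_a (v a)%:MP * \sum_(k < size b) phi (c a k) * b`_k = 0).
    by rewrite -sumrB; apply: eq_bigr => a _; rewrite mulrBr comp_mpolyZ -mul_mpolyC.
  under eq_bigr do rewrite mulr_sumr.
  rewrite exchange_big big1 // => k _.
  have := congr1 (fun p => phi p * b`_k) (E k).
  rewrite rmorph0 mul0r => E'; apply: etrans E'; rewrite rmorph_sum mulr_suml.
  by apply: eq_bigr => a _; rewrite /phi /= comp_mpolyZ -mul_mpolyC mulrA.
by elim/big_rec: _ => // a y _ Iy; apply: ID => //; apply: IM => //; apply: (Hc a).2.
Qed.
End Dependence.

(** * Regular sequences in polynomial rings *)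

Lemma coefM_top (S : nzRingType) (p q : {poly S}) (a b : nat) :
  (size p <= a.+1)%N -> (size q <= b.+1)%N -> (p * q)`_(a + b) = p`_a * q`_b.
Proof.
move=> sp sq; rewrite coefM.
have lt : (a < (a + b).+1)%N by rewrite ltnS leq_addr.
rewrite (bigD1 (Ordinal lt)) //= addKn big1 ?addr0 // => i ni.
case: (ltngtP i a) => [ia|ia|ia].
- rewrite [q`_(_)]nth_default ?mulr0 //; apply: leq_trans sq _; lia.
- by rewrite [p`_i]nth_default ?mul0r //; apply: leq_trans sp _.
by case/eqP: ni; apply: val_inj.
Qed.

Lemma sizeM_top (S : nzRingType) (p q : {poly S}) (a b : nat) :
  (size p <= a.+1)%N -> (size q <= b.+1)%N -> (size (p * q)%R <= (a + b).+1)%N.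
Proof.
move=> sp sq; apply: leq_trans (size_polyMleq _ _) _.
by move: (size p) (size q) sp sq => x y; lia.
Qed.

(** The change of variables from Noether normalization: if [d] is the degree of [P] and [H] its top
    homogeneous part, the coefficient of ['X^d] in [to_uni c P] is the constant [H(c)]. *)
Lemma normalize_lead (K : closedFieldType) (n : nat) (P : {mpoly K[n.+1]}) :
  P != 0 -> exists2 c : 'I_n.+1 -> K, c ord_max != 0 &
    exists2 u, u != 0 & lead_coef (to_uni c P) = u%:MP.
Proof.
move=> nP; pose d := mdeg (mlead P); pose H := pihomog mdeg d P.
have nH : H != 0.
  apply/eqP=> /(congr1 (mcoeff (mlead P))) /eqP.
  rewrite mcoeff0 /H pihomogE raddf_sum /= big_mkcond.
  rewrite (bigD1_seq (mlead P)) ?msupp_uniq ?mlead_supp //= eqxx.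
  rewrite mcoeffZ mcoeffX eqxx mulr1 big1 ?addr0 ?mleadc_eq0 ?(negPf nP) //.
  by move=> m nm; case: ifP => // _; rewrite mcoeffZ mcoeffX (negPf nm) mulr0.
(* The extra factor forces the last coordinate of [c] to be nonzero, so that the change of variables
   is invertible. *)
have [|c] := @mpoly_nonvanishing _ _ (H * 'X_ord_max).
  by rewrite mulf_neq0 // -msize_poly_eq0 msizeX.
rewrite mevalM mevalXU mulf_eq0 negb_or => /andP[Hc cn].
exists c => //; exists H.@[c] => //.
have factor i : (size (to_uni c 'X_i) <= 2)%N /\ (to_uni c 'X_i)`_1 = (c i)%:MP.
  rewrite to_uniX coefD coefZ coefX mulr1; split.
    apply: leq_trans (size_polyD _ _) _; rewrite geq_max; apply/andP; split.
      case: unlift => [j|]; last by rewrite size_poly0.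
      exact: leq_trans (size_polyC_leq1 _) _.
    by apply: leq_trans (size_scale_leq _ _) _; rewrite size_polyX.
  by case: unlift => [j|]; rewrite ?coefC ?coef0 add0r.
have power i k : (size (to_uni c 'X_i ^+ k) <= k.+1)%N /\
    (to_uni c 'X_i ^+ k)`_k = (c i ^+ k)%:MP.
  have [f1 f2] := factor i; elim: k => [|k [IH1 IH2]].
    by rewrite !expr0 size_poly1 coef1.
  rewrite !exprS; split.
    by rewrite -[k.+1]add1n sizeM_top.
  by rewrite -[k.+1]add1n coefM_top // f2 IH2 -rmorphM.
have mono m : (size (to_uni c 'X_[m]) <= (mdeg m).+1)%N /\
    (to_uni c 'X_[m])`_(mdeg m) = ('X_[m].@[c])%:MP.
  rewrite mpolyXE_id !rmorph_prod mdegE /=.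
  elim: (index_enum _) => [|i r [IH1 IH2]]; first by rewrite !big_nil size_poly1 coef1.
  have [p1 p2] := power i (m i); rewrite !big_cons !rmorphXn /= mevalXU; split.
    exact: sizeM_top.
  by rewrite coefM_top // p2 IH2 rmorphXn.
have E : to_uni c P = \sum_(m <- msupp P) (P@_m)%:MP *: to_uni c 'X_[m].
  rewrite {1}(mpolyE P) rmorph_sum; apply: eq_bigr => m _.
  by rewrite -mul_mpolyC rmorphM /= to_uniC mul_polyC.
have le m : m \in msupp P -> (mdeg m <= d)%N.
  by move/msupp_le_mlead/lemc_mdeg.
have sz : (size (to_uni c P) <= d.+1)%N.
  rewrite E big_seq; elim/big_rec: _ => [|m y mP IH]; first by rewrite size_poly0.
  apply: leq_trans (size_polyD _ _) _; rewrite geq_max IH andbT.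
  apply: leq_trans (size_scale_leq _ _) _; apply: leq_trans (mono m).1 _.
  by rewrite ltnS le.
have co : (to_uni c P)`_d = (H.@[c])%:MP.
  have -> : H.@[c] = \sum_(m <- msupp P | mdeg m == d) P@_m * 'X_[m].@[c].
    rewrite /H pihomogE (raddf_sum (meval c)); apply: eq_bigr => m _.
    by rewrite /= mevalZ.
  rewrite E coef_sum (raddf_sum (@mpolyC n K)) [RHS]big_mkcond /=.
  rewrite big_seq [RHS]big_seq; apply: eq_bigr => m mP; rewrite coefZ.
  case: eqP => [<-|/eqP nm].
    by rewrite (mono m).2 rmorphM.
  rewrite nth_default ?mulr0 //; apply: leq_trans (mono m).1 _.
  by rewrite ltn_neqAle nm le.
have ds : (d < size (to_uni c P))%N.
  by rewrite ltnNge; apply: contra Hc => /(nth_default 0); rewrite co => /eqP; rewrite mpolyC_eq0.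
rewrite -co lead_coefE; congr _`_ _; apply/eqP; rewrite eqn_leq.
by move: (size _) sz ds => x; lia.
Qed.

Section RegularSequences.
Implicit Type S : comNzRingType.

(* The head of the list is the last element of the regular sequence. *)
Fixpoint regular_rev (S : comNzRingType) (a : seq S) : Prop :=
  if a is x :: a' then
    (forall h, gspan idfun a' (x * h) -> gspan idfun a' h) /\ regular_rev a'
  else True.

Lemma gspan_map (S S' : comNzRingType) (h : {rmorphism S -> S'}) a f :
  gspan idfun a f -> gspan idfun (map h a) (h f).
Proof.
elim: a f => /= [f ->|x a IH f [c /IH H]]; first exact: rmorph0.
by exists (h c); rewrite rmorphB rmorphM in H.
Qed.

Lemma regular_rev_iso (S S' : comNzRingType) (h : {rmorphism S -> S'})
    (h' : {rmorphism S' -> S}) (a : seq S) :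
  cancel h h' -> cancel h' h -> regular_rev a -> regular_rev (map h a).
Proof.
move=> hK h'K; have back e f : gspan idfun (map h e) f -> gspan idfun e (h' f).
  by move/(gspan_map h'); rewrite -map_comp map_id_in // => x _; apply: hK.
elim: a => //= x a IH [H /IH r]; split=> // f.
move/back; rewrite rmorphM hK => /H/(gspan_map h).
by rewrite h'K.
Qed.

Lemma gspan_polyC S (a : seq S) (f : {poly S}) :
  gspan idfun (map polyC a) f <-> forall i, gspan idfun a f`_i.
Proof.
split=> [|H].
  move: f; apply: gspan_ind => [i|f g Hf Hg i|b g].
  - by rewrite coef0; apply: gspan0.
  - by rewrite coefD; apply: gspanD.
  - case/mapP=> x xa -> i; rewrite coefMC; exact/(gspanM (phi := idfun))/gspan_mem.
rewrite -(coefK f) poly_def; apply: gspan_sum => i _.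
rewrite -mul_polyC mulrC; apply: (gspanM (phi := idfun)).
exact: (gspan_map polyC).
Qed.

Lemma regular_rev_polyC S (a : seq S) : regular_rev a -> regular_rev (map polyC a).
Proof.
elim: a => //= x a IH [H /IH r]; split=> // f /gspan_polyC Hf.
by apply/gspan_polyC => i; apply: H; have := Hf i; rewrite coefCM.
Qed.

(** Downward induction on [i]: with [d] the degree of [p], the coefficient of [p * h] at [d + i] is
    a unit times [h_i] plus multiples of higher coefficients of [h], which already lie in [I]. *)
Lemma lead_unit_regular S (I : S -> Prop) (p h : {poly S}) (u : S) :
  submod idfun I -> u * lead_coef p = 1 ->
  (forall i, I (p * h)`_i) -> forall i, I h`_i.
Proof.
move=> [I0 ID IM] up H.
have IN x : I x -> I (- x) by move=> Ix; rewrite -mulN1r; apply: IM.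
have [k] := ubnP (size h); move=> le i.
have [j] := ubnP (size h - i)%N; elim: j i => // j IH i lt.
case: (ltnP i (size h)) => [ih|]; last by move/(nth_default 0) => ->.
pose d := (size p).-1.
have lti : (d < (d + i).+1)%N by rewrite ltnS leq_addr.
have := H (d + i)%N; rewrite coefM (bigD1 (Ordinal lti)) //= addKn.
set s := \sum_(_ | _) _ => Hs.
suff Is : I s.
  have := IM u _ (ID _ _ Hs (IN _ Is)); rewrite addrK /= mulrA.
  by rewrite -[p`__]/(lead_coef p) up mul1r.
rewrite /s; elim/big_rec: _ => // l y nl Iy; apply: ID => //.
case: (ltngtP l d) => [ld|ld|ld].
- by apply: IM; apply: IH; lia.
- by rewrite nth_default ?mul0r //; apply: leq_trans (leqSpred _) ld.
by case/eqP: nl; apply: val_inj.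
Qed.

(* The hypothesis says that K[X]/J has dimension at most r. A relation P in J, made monic in the last
   variable, is regular modulo any ideal generated by polynomials in the other variables. *)
Lemma exists_regular_sequence (K : closedFieldType) (r k n : nat)
    (J : {mpoly K[n]} -> Prop) :
  (r + k <= n)%N -> submod idfun J ->
  (forall m (x : m.-tuple {mpoly K[n]}), (r < m)%N ->
     exists2 P : {mpoly K[m]}, P != 0 & J (P \mPo x)) ->
  exists2 a, size a = k /\ (forall x, x \in a -> J x) & regular_rev a.
Proof.
elim: k n J => [|k IH] n J le sJ dep; first by exists [::].
case: n => [|n] in J le sJ dep *; rewrite addnS // in le.
(* Applied to the variables themselves, more than [r] in number, the hypothesis yields a nonzero
   element of [J]. *)
have [P nP] := dep n.+1 [tuple 'X_i | i < n.+1] (leq_trans (leq_addr k r) le).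
rewrite comp_mpoly_id => JP.
have [c cn [u nu Eu]] := normalize_lead nP.
have [J0 JD JM] := sJ.
(* The induction hypothesis is applied to the contraction of [J] to the polynomials without the last
   variable, in the new coordinates. *)
have [||m x rm|a [sa Ja] ra] := IH n (fun q => J (of_uni c q%:P)).
- exact: le.
- split=> [|f g Jf Jg|a f Jf]; rewrite ?rmorph0 ?rmorphD ?rmorphM //=.
    exact: JD.
  exact: JM.
- have [Q nQ JQ] := dep m [tuple of map (of_uni c \o polyC) x] rm.
  exists Q => //; move: JQ; congr J.
  apply: (mpoly_rmorph_ext (h1 := comp_mpoly _) (h2 := of_uni c \o polyC \o comp_mpoly x)) => [b|i] /=.
    by rewrite !comp_mpolyC of_uniC /of_uni_coef comp_mpolyC.
  by rewrite !comp_mpolyXU -!tnth_nth tnth_map.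
exists (P :: map (of_uni c) (map polyC a)).
  split=> [|x]; first by rewrite /= !size_map sa.
  rewrite inE => /predU1P[->//|]; case/mapP=> y /mapP [z za ->] ->.
  exact: Ja.
have rp : regular_rev (to_uni c P :: map polyC a).
  split; last exact: regular_rev_polyC.
  move=> h /gspan_polyC H; apply/gspan_polyC.
  apply: (lead_unit_regular (u := (u^-1)%:MP)) H; first exact: submod_gspan.
  by rewrite Eu -rmorphM mulVf.
pose h : {rmorphism {poly {mpoly K[n]}} -> {mpoly K[n.+1]}} := of_uni c.
pose h' : {rmorphism {mpoly K[n.+1]} -> {poly {mpoly K[n]}}} := to_uni c.
have hK : cancel h h' by exact: of_uniK.
have hK' : cancel h' h by exact: to_uniK.
have := regular_rev_iso hK hK' rp.
rewrite /= to_uniK //.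
Qed.

End RegularSequences.

(** * The action on the coordinate ring *)

Lemma det2 (S : comNzRingType) (M : 'M[S]_2) : \det M = M 0 0 * M 1 1 - M 0 1 * M 1 0.
Proof.
rewrite (expand_det_row _ 0) !big_ord_recl big_ord0 /cofactor.
rewrite !det_mx11 !mxE /= !addn0 expr0 expr1 mul1r mulN1r addr0 mulrN.
by congr (M _ _ * M _ _ - M _ _ * M _ _); apply: val_inj.
Qed.

Lemma exists_SL2 (K : fieldType) (a b c d : K) : a * d - b * c = 1 ->
  exists s : SL2 K, [/\ SL2val s 0 0 = a, SL2val s 0 1 = b, SL2val s 1 0 = c & SL2val s 1 1 = d].
Proof.
move=> E; pose M : 'M[K]_2 := \matrix_(i, j)
  (if i == 0 then if j == 0 then a else b else if j == 0 then c else d).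
have dM : \det M == 1 by rewrite det2 !mxE E.
by exists (MkSL2 dM); rewrite /= !mxE.
Qed.

(** Lets the ten variables be treated as five pairs [xx k], [yy k]. *)
Lemma idx_ind (P : 'I_10 -> Prop) :
  (forall k, (k < 5)%N -> P (inord k.*2) /\ P (inord k.*2.+1)) -> forall j, P j.
Proof.
move=> H j; have lt : (j./2 < 5)%N by have := ltn_ord j; lia.
have [H0 H1] := H _ lt; have := odd_double_half j; case: (odd j) => /= E.
  by rewrite -[j]inord_val -E add1n.
by rewrite -[j]inord_val -E add0n.
Qed.

Section Action.
Variables (K : closedFieldType) (hK : 2%N \in [pchar K]).
Notation T := {mpoly K[10]}.
Implicit Types s : SL2 K.

Definition sl2_act s (f : T) : T := @coord_act K (V hK) s f.

Lemma actE s f : sl2_act s f = f \mPo [tuple \sum_(i < 10) Vstar hK s i j *: 'X_i | j < 10].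
Proof.
rewrite /sl2_act /coord_act; congr (_ \mPo _); apply: eq_from_tnth => j.
by rewrite !tnth_mktuple; apply: eq_bigr => i _; rewrite dualK.
Qed.

Lemma actX s (j : 'I_10) : sl2_act s 'X_j = \sum_(i < 10) Vstar hK s i j *: 'X_i.
Proof. by rewrite actE comp_mpolyXU -tnth_nth tnth_mktuple. Qed.

Lemma dsum_suml (M N : gmodule K) s (W : lmodType K)
    (g : 'I_(gm_dim M + gm_dim N) -> W) j :
  \sum_i dsum M N s i (lshift _ j) *: g i = \sum_i M s i j *: g (lshift _ i).
Proof.
rewrite big_split_ord /= [X in _ + X]big1 ?addr0 => [|i _]; last first.
  by rewrite block_mxEdl mxE scale0r.
by apply: eq_bigr => i _; rewrite block_mxEul.
Qed.

Lemma dsum_sumr (M N : gmodule K) s (W : lmodType K)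
    (g : 'I_(gm_dim M + gm_dim N) -> W) j :
  \sum_i dsum M N s i (rshift _ j) *: g i = \sum_i N s i j *: g (rshift _ i).
Proof.
rewrite big_split_ord /= big1 ?add0r => [|i _]; last first.
  by rewrite block_mxEur mxE scale0r.
by apply: eq_bigr => i _; rewrite block_mxEdr.
Qed.

(* xx 0 and yy 0 are the variables X^2 and Y^2; for k > 0, xx k and yy k are X_k and Y_k. *)
Definition xx k : T := 'X_(inord k.*2).
Definition yy k : T := 'X_(inord k.*2.+1).

Let N1 := nat_module K.

(** This and the next four facts restrict the action to one summand each. Indices are spelled out as
    nested shifts to match the nesting of [dsum] in [Vstar]. *)
Let sum_sq s (g : 'I_10 -> T) (j : 'I_2) :
  \sum_(i < 10) Vstar hK s i (lshift 8 j : 'I_(2 + 8)) *: g i =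
  \sum_(i < 2) sq_rep s i j *: g (lshift 8 i : 'I_(2 + 8)) :=
  @dsum_suml (sq_module hK) (dsum N1 (dsum N1 (dsum N1 N1))) s T g j.

Let sum1 s (g : 'I_10 -> T) (j : 'I_2) :
  \sum_(i < 10) Vstar hK s i (rshift 2 (lshift 6 j : 'I_(2 + 6)) : 'I_(2 + 8)) *: g i =
  \sum_(i < 2) SL2val s i j *: g (rshift 2 (lshift 6 i : 'I_(2 + 6)) : 'I_(2 + 8)) :=
  etrans (@dsum_sumr (sq_module hK) (dsum N1 (dsum N1 (dsum N1 N1))) s T g (lshift 6 j))
    (@dsum_suml N1 (dsum N1 (dsum N1 N1)) s T _ j).

Let sum2 s (g : 'I_10 -> T) (j : 'I_2) :
  \sum_(i < 10) Vstar hK s i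
    (rshift 2 (rshift 2 (lshift 4 j : 'I_(2 + 4)) : 'I_(2 + 6)) : 'I_(2 + 8)) *: g i =
  \sum_(i < 2) SL2val s i j *:
    g (rshift 2 (rshift 2 (lshift 4 i : 'I_(2 + 4)) : 'I_(2 + 6)) : 'I_(2 + 8)) :=
  etrans (@dsum_sumr (sq_module hK) (dsum N1 (dsum N1 (dsum N1 N1))) s T g
    (rshift 2 (lshift 4 j : 'I_(2 + 4)) : 'I_(2 + 6)))
  (etrans (@dsum_sumr N1 (dsum N1 (dsum N1 N1)) s T _ (lshift 4 j))
    (@dsum_suml N1 (dsum N1 N1) s T _ j)).

Let sum3 s (g : 'I_10 -> T) (j : 'I_2) :
  \sum_(i < 10) Vstar hK s i
    (rshift 2 (rshift 2 (rshift 2 (lshift 2 j : 'I_(2 + 2)) : 'I_(2 + 4)) : 'I_(2 + 6)) : 'I_(2 + 8)) *: g i =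
  \sum_(i < 2) SL2val s i j *:
    g (rshift 2 (rshift 2 (rshift 2 (lshift 2 i : 'I_(2 + 2)) : 'I_(2 + 4)) : 'I_(2 + 6)) : 'I_(2 + 8)) :=
  etrans (@dsum_sumr (sq_module hK) (dsum N1 (dsum N1 (dsum N1 N1))) s T g
    (rshift 2 (rshift 2 (lshift 2 j : 'I_(2 + 2)) : 'I_(2 + 4)) : 'I_(2 + 6)))
  (etrans (@dsum_sumr N1 (dsum N1 (dsum N1 N1)) s T _ (rshift 2 (lshift 2 j : 'I_(2 + 2)) : 'I_(2 + 4)))
  (etrans (@dsum_sumr N1 (dsum N1 N1) s T _ (lshift 2 j))
    (@dsum_suml N1 N1 s T _ j))).

Let sum4 s (g : 'I_10 -> T) (j : 'I_2) :
  \sum_(i < 10) Vstar hK s i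
    (rshift 2 (rshift 2 (rshift 2 (rshift 2 j : 'I_(2 + 2)) : 'I_(2 + 4)) : 'I_(2 + 6)) : 'I_(2 + 8)) *: g i =
  \sum_(i < 2) SL2val s i j *:
    g (rshift 2 (rshift 2 (rshift 2 (rshift 2 i : 'I_(2 + 2)) : 'I_(2 + 4)) : 'I_(2 + 6)) : 'I_(2 + 8)) :=
  etrans (@dsum_sumr (sq_module hK) (dsum N1 (dsum N1 (dsum N1 N1))) s T g
    (rshift 2 (rshift 2 (rshift 2 j : 'I_(2 + 2)) : 'I_(2 + 4)) : 'I_(2 + 6)))
  (etrans (@dsum_sumr N1 (dsum N1 (dsum N1 N1)) s T _ (rshift 2 (rshift 2 j : 'I_(2 + 2)) : 'I_(2 + 4)))
  (etrans (@dsum_sumr N1 (dsum N1 N1) s T _ (rshift 2 j))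
    (@dsum_sumr N1 N1 s T _ j))).

Lemma sum_col (g : 'I_2 -> T) (c : 'I_2 -> K) :
  \sum_(i < 2) c i *: g i = (c 0)%:MP * g 0 + (c 1)%:MP * g 1.
Proof. by rewrite !mul_mpolyC big_ord_recl big_ord1; congr (_ + c _ *: g _); apply: val_inj. Qed.

Let act_block s (M : 'M[K]_2) k (e : 'I_2 -> 'I_10) :
  (forall g j, \sum_(i < 10) Vstar hK s i (e j) *: g i = \sum_(i < 2) M i j *: g (e i) :> T) ->
  (k < 5)%N -> (forall j, e j = k.*2 + j :> nat)%N ->
  sl2_act s (xx k) = (M 0 0)%:MP * xx k + (M 1 0)%:MP * yy k /\
  sl2_act s (yy k) = (M 0 1)%:MP * xx k + (M 1 1)%:MP * yy k.
Proof.
move=> H k5 eE.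
have E0 : inord k.*2 = e 0 by apply: val_inj; rewrite /= eE inordK ?addn0 //; lia.
have E1 : inord k.*2.+1 = e 1 by apply: val_inj; rewrite /= eE inordK ?addn1 //; lia.
by split; rewrite /xx /yy E0 E1 actX H sum_col.
Qed.

Lemma act_sq s (m := SL2val s) :
  sl2_act s (xx 0) = (m 0 0 ^+ 2)%:MP * xx 0 + (m 1 0 ^+ 2)%:MP * yy 0 /\
  sl2_act s (yy 0) = (m 0 1 ^+ 2)%:MP * xx 0 + (m 1 1 ^+ 2)%:MP * yy 0.
Proof. by have := act_block (k := 0) (@sum_sq s) isT (fun=> erefl); rewrite !mxE. Qed.

Lemma act_nat s (m := SL2val s) k : (0 < k < 5)%N ->
  sl2_act s (xx k) = (m 0 0)%:MP * xx k + (m 1 0)%:MP * yy k /\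
  sl2_act s (yy k) = (m 0 1)%:MP * xx k + (m 1 1)%:MP * yy k.
Proof.
case: k => [|[|[|[|[|k]]]]] // _.
- exact: (act_block (k := 1) (@sum1 s)).
- exact: (act_block (k := 2) (@sum2 s)).
- exact: (act_block (k := 3) (@sum3 s)).
- exact: (act_block (k := 4) (@sum4 s)).
Qed.

HB.instance Definition _ s := GRing.RMorphism.copy (sl2_act s)
  (comp_mpoly [tuple \sum_(i < 10) dual (V hK) s i j *: 'X_i | j < 10] : {mpoly K[10]} -> _).

Lemma actC s c : sl2_act s c%:MP = c%:MP.
Proof. exact: comp_mpolyC. Qed.

Lemma act_comp s t f : sl2_act (s * t)%g f = sl2_act s (sl2_act t f).
Proof.
apply: (mpoly_rmorph_ext (h1 := sl2_act (s * t)%g) (h2 := sl2_act s \o sl2_act t)) => [c|j] /=.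
  by rewrite !actC.
rewrite !actX gmM rmorph_sum.
under [RHS]eq_bigr => i _ do rewrite -mul_mpolyC rmorphM /= actC actX mul_mpolyC scaler_sumr.
rewrite exchange_big; apply: eq_bigr => i _.
rewrite mxE scaler_suml; apply: eq_bigr => k _.
by rewrite scalerA mulrC.
Qed.

Lemma char2 (n : nat) (x : {mpoly K[n]}) : x + x = 0.
Proof.
have E2 : 1 + 1 = 0 :> K by have /andP[_ /eqP] := hK.
by rewrite -[x]mul1r -mulrDl -(rmorph1 (@mpolyC n K)) -rmorphD /= E2 rmorph0 mul0r.
Qed.

(** [ring] does not know the characteristic, so identities in characteristic [2] are proved by
    exhibiting the surplus terms as [z + z]. *)
Lemma eq_char2 (n : nat) (x y z : {mpoly K[n]}) : x = y + (z + z) -> x = y.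
Proof. by rewrite char2 addr0. Qed.

Lemma det_poly s (m := SL2val s) :
  (m 0 0)%:MP * (m 1 1)%:MP = 1 + (m 0 1)%:MP * (m 1 0)%:MP :> T.
Proof.
rewrite -!rmorphM -(rmorph1 (@mpolyC 10 K)) -rmorphD /=; congr (_%:MP).
have := SL2_det s; rewrite -/m det2 => /eqP.
by rewrite subr_eq => /eqP.
Qed.

(* GG i is the square of f_{0i}, if X^2 and Y^2 are read as squares of coordinates X_0 and Y_0.
   The cocycle gg is s |-> s(XY) - XY, computed in the symmetric square of <X, Y>. *)
Definition FF i j : T := xx i * yy j + xx j * yy i.
Definition GG i : T := xx i ^+ 2 * yy 0 + yy i ^+ 2 * xx 0.
Definition vv i j : T := xx 0 * yy i * yy j + yy 0 * xx i * xx j.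
Definition gg s (m := SL2val s) : T :=
  (m 0 0 * m 0 1) *: xx 0 + (m 1 0 * m 1 1) *: yy 0.

Lemma act_FF s i j : (0 < i < 5)%N -> (0 < j < 5)%N -> sl2_act s (FF i j) = FF i j.
Proof.
move=> hi hj; have [xi yi] := act_nat s hi; have [xj yj] := act_nat s hj.
rewrite /FF rmorphD !rmorphM /= xi yi xj yj; move: (det_poly s).
set a := (_ 0 0)%:MP; set b := (_ 0 1)%:MP; set c := (_ 1 0)%:MP; set d := (_ 1 1)%:MP => E.
apply: (@eq_char2 _ _ _ (a * b * xx i * xx j + c * d * yy i * yy j
   + b * c * (xx i * yy j + xx j * yy i))).
transitivity ((a * d) * (xx i * yy j + xx j * yy i) + b * c * (xx i * yy j + xx j * yy i)
  + (a * b * xx i * xx j + c * d * yy i * yy j) + (a * b * xx i * xx j + c * d * yy i * yy j)).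
  by ring.
by rewrite E; ring.
Qed.

Lemma act_GG s i : (0 < i < 5)%N -> sl2_act s (GG i) = GG i.
Proof.
move=> hi; have [xi yi] := act_nat s hi; have [p q] := act_sq s.
rewrite /GG rmorphD !rmorphM /= xi yi p q !rmorphM /=; move: (det_poly s).
set a := (_ 0 0)%:MP; set b := (_ 0 1)%:MP; set c := (_ 1 0)%:MP; set d := (_ 1 1)%:MP => E.
(* [W] gathers the monomials that occur twice in the expansion; the rest of the witness comes from
   replacing [a d] by [1 + b c]. *)
pose W := a ^+ 2 * b ^+ 2 * xx i ^+ 2 * xx 0 + c ^+ 2 * d ^+ 2 * yy i ^+ 2 * yy 0
  + a * c * xx i * yy i * (b ^+ 2 * xx 0 + d ^+ 2 * yy 0)
  + b * d * xx i * yy i * (a ^+ 2 * xx 0 + c ^+ 2 * yy 0).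
pose Z := xx i ^+ 2 * yy 0 + yy i ^+ 2 * xx 0.
apply: (@eq_char2 _ _ _ (W + b * c * Z + (b * c) ^+ 2 * Z)).
transitivity ((a * d) ^+ 2 * Z + (b * c) ^+ 2 * Z + (W + W)); first by rewrite /W /Z; ring.
by rewrite E /Z; ring.
Qed.

(** This formula serves twice: it shows that [FF i j] annihilates [gg], and it yields the cocycle
    identity of [gg]. *)
Lemma act_vv s i j : (0 < i < 5)%N -> (0 < j < 5)%N ->
  sl2_act s (vv i j) = vv i j + FF i j * gg s.
Proof.
move=> hi hj; have [xi yi] := act_nat s hi; have [xj yj] := act_nat s hj.
have [p q] := act_sq s.
rewrite /vv /gg rmorphD !rmorphM /= xi yi xj yj p q -!mul_mpolyC !rmorphM /=.
move: (det_poly s).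
set a := (_ 0 0)%:MP; set b := (_ 0 1)%:MP; set c := (_ 1 0)%:MP; set d := (_ 1 1)%:MP => E.
pose W := a ^+ 2 * b ^+ 2 * xx 0 * xx i * xx j + c ^+ 2 * d ^+ 2 * yy 0 * yy i * yy j.
pose Z := xx 0 * yy i * yy j + yy 0 * xx i * xx j.
pose H := (a * b * xx 0 + c * d * yy 0).
apply: (@eq_char2 _ _ _ (W + b * c * FF i j * H + (b * c + (b * c) ^+ 2) * Z)).
transitivity ((a * d) ^+ 2 * Z + (b * c) ^+ 2 * Z + (a * d + b * c) * FF i j * H + (W + W)).
  by rewrite /W /Z /H /FF; ring.
by rewrite E /Z /H; ring.
Qed.

(** * Leading monomials of the invariants and independence of [theta] *)

Definition ee k : 'X_{1..10} := U_(inord k)%MM.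

Lemma eeE k (j : 'I_10) : (k < 10)%N -> ee k j = (k == j :> nat).
Proof. by move=> lt; rewrite /ee mnm1E -val_eqE /= inordK. Qed.

Lemma xxE k : xx k = 'X_[ee k.*2]. Proof. by []. Qed.
Lemma yyE k : yy k = 'X_[ee k.*2.+1]. Proof. by []. Qed.

Lemma mdeg_ee k : mdeg (ee k) = 1%N. Proof. exact: mdeg1. Qed.

Lemma mlead_FF i j : (0 < i)%N -> (i < j < 5)%N ->
  mlead (FF i j) = (ee i.*2 + ee j.*2.+1)%MM.
Proof.
move=> i0 /andP[ij j5]; rewrite /FF !xxE !yyE -!mpolyXD mleadDl !mleadXm //.
have lt : (i.*2 < 10)%N by lia.
(* Among monomials of equal degree the order is lexicographic with earlier variables larger; these
   two differ first at [X_i]. *)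
apply/ltmcP; rewrite ?mdegD ?mdeg_ee //; exists (Ordinal lt) => [k /= ki|].
  by rewrite !mnmDE !eeE; lia.
by rewrite !mnmDE !eeE //=; lia.
Qed.

Lemma mlead_GG i : (0 < i < 5)%N ->
  mlead (GG i) = (ee i.*2.+1 *+ 2 + ee 0)%MM.
Proof.
move=> hi; rewrite /GG !xxE !yyE !mpolyXn -!mpolyXD addrC mleadDl !mleadXm //.
apply/ltmcP; rewrite ?mdegD ?mdegMn ?mdeg_ee //; exists (Ordinal (isT : 0 < 10)%N) => //=.
by rewrite !(mnmDE, mulmnE) !eeE /=; lia.
Qed.

Lemma mlead_neq0 (f : T) : mlead f != 0%MM -> f != 0.
Proof. by apply: contraNneq => ->; rewrite mlead0. Qed.

Lemma FF_neq0 i j : (0 < i)%N -> (i < j < 5)%N -> FF i j != 0.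
Proof.
move=> i0 ij; apply: mlead_neq0; rewrite mlead_FF // -mdeg_eq0 mdegD !mdeg_ee.
by [].
Qed.

Lemma GG_neq0 i : (0 < i < 5)%N -> GG i != 0.
Proof. by move=> hi; apply: mlead_neq0; rewrite mlead_GG // -mdeg_eq0 mdegD mdegMn !mdeg_ee. Qed.

(** The exponents [2] and [3] balance the degrees [3] of [GG] and [2] of [FF], making the sum
    homogeneous of degree [6]. *)
Definition theta_sum (i a b c d : nat) : T := GG i ^+ 2 + (FF a b ^+ 3 + FF c d ^+ 3).

(** The square of [GG i] dominates because its leading monomial contains the first variable [xx 0],
    absent from every [FF] involved. *)
Lemma mlead_theta_sum i a b c d : (0 < i < 5)%N -> (0 < a)%N -> (a < b < 5)%N ->
  (0 < c)%N -> (c < d < 5)%N ->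
  mlead (theta_sum i a b c d) = (ee i.*2.+1 *+ 4 + ee 0 *+ 2)%MM.
Proof.
move=> hi a0 ab c0 cd; have lG : mlead (GG i ^+ 2) = (ee i.*2.+1 *+ 4 + ee 0 *+ 2)%MM.
  rewrite mleadX ?GG_neq0 // mlead_GG //; apply/mnmP=> j.
  by rewrite !(mnmDE, mulmnE); lia.
have lt x y : (0 < x)%N -> (x < y < 5)%N -> (mlead (FF x y ^+ 3) < mlead (GG i ^+ 2))%O.
  move=> x0 xy; rewrite lG mleadX ?FF_neq0 // mlead_FF //.
  apply/ltmcP; rewrite ?(mdegD, mdegMn, mdeg_ee) //; exists (Ordinal (isT : 0 < 10)%N) => //=.
  by rewrite !(mnmDE, mulmnE) !eeE /=; lia.
rewrite /theta_sum mleadDl // (le_lt_trans (mleadD_le _ _)) //.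
by rewrite ltUx !lt.
Qed.

(* Where theta vanishes, so do all f_ij and g_i: the remaining f_13, f_14, f_24, g_2, g_3 satisfy
   f_13 f_24 = 0 and f_13^2 g_2 = f_14^2 g_2 = f_14^2 g_3 = f_24^2 g_3 = 0 (Pluecker relations). *)
Definition theta : seq T :=
  [:: FF 1 2; FF 2 3; FF 3 4; GG 1; GG 4; theta_sum 2 1 3 1 4; theta_sum 3 2 4 1 4].

Lemma theta_neq0 f : f \in theta -> f != 0.
Proof.
have t0 i a b c d : (0 < i < 5)%N -> (0 < a)%N -> (a < b < 5)%N ->
    (0 < c)%N -> (c < d < 5)%N -> theta_sum i a b c d != 0.
  move=> *; apply: mlead_neq0; rewrite mlead_theta_sum // -mdeg_eq0 mdegD !mdegMn !mdeg_ee.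
  by [].
suff /allP : all (fun f => f != 0) theta by apply.
by apply/and5P; split; [exact: FF_neq0..|exact: GG_neq0|rewrite GG_neq0 ?t0].
Qed.

Definition theta_leads : seq 'X_{1..10} :=
  [:: ee 2 + ee 5; ee 4 + ee 7; ee 6 + ee 9; ee 3 *+ 2 + ee 0; ee 9 *+ 2 + ee 0;
      ee 5 *+ 4 + ee 0 *+ 2; ee 7 *+ 4 + ee 0 *+ 2]%MM.

Lemma mlead_theta : map (@mlead 10 K) theta = theta_leads.
Proof.
rewrite /theta !map_cons; congr [:: _, _, _, _, _, _ & _].
- exact: mlead_FF.
- exact: mlead_FF.
- exact: mlead_FF.
- exact: mlead_GG.
- exact: mlead_GG.
- exact: mlead_theta_sum.
- by rewrite /= mlead_theta_sum.
Qed.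

Lemma ee_inord a k : (a < 10)%N -> (k < 10)%N -> ee a (inord k) = (a == k) :> nat.
Proof. by move=> a10 k10; rewrite eeE // inordK. Qed.

(** The exponents of [X_1], [X_2], [X_3], [Y_1] each isolate one unknown; those of [Y_4], [Y_2],
    [Y_3] then determine the other three, so the linear system is triangular. *)
Lemma theta_alg_independent : alg_independent theta.
Proof.
apply: lead_alg_independent => [|m m' E]; first exact: theta_neq0.
have H k l : map (fun mm : 'X_{1..10} => mm (inord k)) (map (@mlead 10 K) theta) = l ->
    (\sum_(i < 7) nth 0%N l i * nth 0%N m i = \sum_(i < 7) nth 0%N l i * nth 0%N m' i)%N.
  move=> <-; suff conv (mm : 'X_{1..7}) :
      \sum_(i < 7) nth 0%N (map (fun mm : 'X_{1..10} => mm (inord k)) (map (@mlead 10 K) theta)) i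
        * nth 0%N mm i = (\sum_(i < size theta) mlead theta`_i *+ mm i)%MM (inord k).
    by rewrite !conv E.
  rewrite mnm_sumE; apply: eq_bigr => i _; rewrite mulmnE (nth_map 0%MM) ?size_map // (nth_map 0) //.
  by congr (_ * _)%N; rewrite (mnm_nth 0%N).
have L k l : map (fun mm : 'X_{1..10} => mm (inord k)) theta_leads = l ->
    foldr addn 0%N [seq (nth 0 l i * nth 0 m i)%N | i <- iota 0 7] =
    foldr addn 0%N [seq (nth 0 l i * nth 0 m' i)%N | i <- iota 0 7].
  by rewrite -mlead_theta => /H; rewrite !big_ord_recl !big_ord0.
have /L H2 : map (fun mm : 'X_{1..10} => mm (inord 2)) theta_leads = [:: 1; 0; 0; 0; 0; 0; 0]%N
  by rewrite /= !(mnmDE, mulmnE) !ee_inord.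
have /L H4 : map (fun mm : 'X_{1..10} => mm (inord 4)) theta_leads = [:: 0; 1; 0; 0; 0; 0; 0]%N
  by rewrite /= !(mnmDE, mulmnE) !ee_inord.
have /L H6 : map (fun mm : 'X_{1..10} => mm (inord 6)) theta_leads = [:: 0; 0; 1; 0; 0; 0; 0]%N
  by rewrite /= !(mnmDE, mulmnE) !ee_inord.
have /L H3 : map (fun mm : 'X_{1..10} => mm (inord 3)) theta_leads = [:: 0; 0; 0; 2; 0; 0; 0]%N
  by rewrite /= !(mnmDE, mulmnE) !ee_inord.
have /L H9 : map (fun mm : 'X_{1..10} => mm (inord 9)) theta_leads = [:: 0; 0; 1; 0; 2; 0; 0]%N
  by rewrite /= !(mnmDE, mulmnE) !ee_inord.
have /L H5 : map (fun mm : 'X_{1..10} => mm (inord 5)) theta_leads = [:: 1; 0; 0; 0; 0; 4; 0]%N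
  by rewrite /= !(mnmDE, mulmnE) !ee_inord.
have /L H7 : map (fun mm : 'X_{1..10} => mm (inord 7)) theta_leads = [:: 0; 1; 0; 0; 0; 0; 4]%N
  by rewrite /= !(mnmDE, mulmnE) !ee_inord.
apply/mnmP=> i; rewrite !(mnm_nth 0%N); move: H2 H3 H4 H5 H6 H7 H9 => {H L E} /=.
case: i => i i7; move: (nth 0%N m) (nth 0%N m') => f f' {m m'} H2 H4 H6 H3 H9 H5 H7.
by case: i i7 => [|[|[|[|[|[|[|i]]]]]]] //= _; lia.
Qed.

(** * The cocycle [gg] and its nontriviality *)

Lemma act_eval s f w : (sl2_act s f).@[w] = f.@[fun j => (sl2_act s 'X_j).@[w]].
Proof.
rewrite actE comp_mpoly_meval; apply: meval_eq => j.
by rewrite tnth_mktuple actX.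
Qed.

(* f_12 gg is a coboundary, and f_12 can be cancelled. *)
Lemma gg_cocycle : cocycle (@coord_act K (V hK)) gg.
Proof.
split.
  exists 2%N, (fun k : 'I_2 => if k == 0 then 'X_(mxvec_index 0 0) * 'X_(mxvec_index 0 1)
     else 'X_(mxvec_index 1 0) * 'X_(mxvec_index 1 1)),
     (fun k : 'I_2 => if k == 0 then xx 0 else yy 0) => s.
  by rewrite !big_ord_recl big_ord0 addr0 /= !mevalM !mevalXU !mxvecE.
move=> s t.
have E u : FF 1 2 * gg u = sl2_act u (vv 1 2) - vv 1 2 by rewrite act_vv // addrC addKr.
have A : FF 1 2 * sl2_act s (gg t) = sl2_act s (FF 1 2 * gg t) by rewrite rmorphM /= act_FF.
have : FF 1 2 * gg (s * t)%g = FF 1 2 * (sl2_act s (gg t) + gg s).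
  by rewrite [RHS]mulrDr A !E rmorphB /= act_comp; ring.
exact: (mulfI (FF_neq0 (isT : 0 < 1)%N (isT : 1 < 2 < 5)%N)).
Qed.

(* Evaluating at X^2 = 1 and all other variables 0, and with s = [1 b; 0 1], a trivialization v
   gives a univariate p with p(b^2) = b for all b; but p(t^2) has derivative 0. *)
Lemma gg_not_coboundary : ~ coboundary (@coord_act K (V hK)) gg.
Proof.
case=> v Hv.
pose h : {mpoly K[10]} -> {poly K} := mmap polyC (fun i : 'I_10 => if i == 0 then 1 else if i == 1 then 'X else 0).
pose p := h v - (h v).[0]%:P.
pose pt b (i : 'I_10) : K := if i == 0 then 1 else if i == 1 then b else 0.
have hE b f : (h f).[b] = f.@[pt b].
  apply: (mpoly_rmorph_ext (h1 := horner_eval b \o h) (h2 := meval (pt b))) => [c|i] /=.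
    by rewrite /h mmapC mevalC /horner_eval hornerC.
  rewrite /h mmapX mmap1U mevalXU /pt /horner_eval.
  by case: ifP => _; [|case: ifP => _]; rewrite !hornerE.
have i0 k : (k < 10)%N ->
    ((inord k == 0 :> 'I_10) = (k == 0)%N) * ((inord k == 1 :> 'I_10) = (k == 1)%N).
  by move=> lt; rewrite -!val_eqE /= inordK.
have Hp b : p.[b ^+ 2] = b.
  rewrite /p hornerD hornerN hornerC !hE.
  have [|s [s00 s01 s10 s11]] := @exists_SL2 K 1 b 0 1; first by rewrite mulr1 mulr0 subr0.
  have := Hv s; move/(congr1 (meval (pt 0))).
  rewrite mevalB -[coord_act _ _]/(sl2_act s v) act_eval /gg mevalD !mevalZ !mevalXU.
  rewrite s00 s01 s10 s11 mul1r mul0r mul0r addr0 {1}/pt i0 // mulr1 => Eb.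
  rewrite [RHS]Eb; congr (_ - _); apply: meval_eq; apply: idx_ind => k k5.
  case: k k5 => [|k] k5.
    have [E1 E2] := act_sq s.
    rewrite -[X in pt _ _ = (sl2_act _ X).@[_] /\ _]/(xx 0) -[X in _ /\ _ = (sl2_act _ X).@[_]]/(yy 0) E1 E2.
    rewrite s00 s01 s10 s11 !mevalD !mevalM !mevalC !mevalXU /pt !i0 //=.
    by rewrite !expr1n !expr0n /= !(mulr1, mul1r, mulr0, mul0r, addr0, add0r).
  have [|E1 E2] := @act_nat s k.+1; first by lia.
  rewrite -[X in pt _ _ = (sl2_act _ X).@[_] /\ _]/(xx k.+1) -[X in _ /\ _ = (sl2_act _ X).@[_]]/(yy k.+1) E1 E2.
  rewrite !mevalD !mevalM !mevalC !mevalXU /pt !i0; try lia.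
  by rewrite /= !mulr0 !addr0.
have infinite_K : ((p \Po 'X^2) - 'X) = 0.
  apply/eqP/negbNE/negP => /closed_nonrootP [b] /negP[]; rewrite /root.
  by rewrite hornerD hornerN hornerX horner_comp hornerXn Hp subrr.
have /eqP := congr1 (fun q : {poly K} => q^`()) infinite_K.
have [_ /eqP E2] := andP hK.
rewrite derivB deriv_comp derivX derivXn deriv0 -mulr_natr -polyC_natr E2 !mulr0 sub0r oppr_eq0.
by rewrite oner_eq0.
Qed.

(** * Self-duality of the module *)

Definition self_dual (M : gmodule K) := exists A B : 'M[K]_(gm_dim M),
  [/\ A *m B = 1%:M, B *m A = 1%:M & forall s, A *m (M s^-1%g)^T = M s *m A].

Lemma self_dual_dsum M N : self_dual M -> self_dual N -> self_dual (dsum M N).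
Proof.
move=> [A [B [AB BA H]]] [A' [B' [AB' BA' H']]].
exists (block_mx A 0 0 A'), (block_mx B 0 0 B'); split=> [||s].
- by rewrite mulmx_block AB AB' !(mulmx0, mul0mx, addr0, add0r) -scalar_mx_block.
- by rewrite mulmx_block BA BA' !(mulmx0, mul0mx, addr0, add0r) -scalar_mx_block.
by rewrite /= /dsum_rep tr_block_mx !trmx0 !mulmx_block !(mulmx0, mul0mx, addr0, add0r) H H'.
Qed.

(** An invariant bilinear form with invertible Gram matrix identifies a module with its dual. *)
Lemma self_dual_form M (J : 'M[K]_(gm_dim M)) : J *m J = 1%:M ->
  (forall s, M s *m J *m (M s)^T = J) -> self_dual M.
Proof.
move=> JJ H; exists J, J; split=> // s.
rewrite -{1}(H s) -!mulmxA -trmx_mul -gmM mulVg gm1 trmx1 mulmx1.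
by [].
Qed.

Let J2 : 'M[K]_2 := \matrix_(i, j) (i != j)%:R.

Let J2J2 : J2 *m J2 = 1%:M.
Proof.
apply/matrixP=> i j; rewrite !mxE !big_ord_recl big_ord0 !mxE addr0.
by case: i j => [[|[|i]] ?] [[|[|j]] ?] //=; rewrite ?(mulr0, mul0r, mulr1, addr0, add0r).
Qed.

(** In characteristic [2] the swap matrix is the Gram matrix of the determinant form, preserved by
    matrices of determinant [1]. *)
Lemma self_dual_J2 (rho : 'M[K]_2) :
  rho 0 0 * rho 1 1 = 1 + rho 0 1 * rho 1 0 -> rho *m J2 *m rho^T = J2.
Proof.
move=> E; have E2 (x : K) : x + x = 0 by have [_ /eqP h] := andP hK; rewrite -mulr2n -mulr_natr h mulr0.
have X i j : (rho *m J2 *m rho^T) i j = rho i 1 * rho j 0 + rho i 0 * rho j 1.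
  rewrite !mxE !big_ord_recl big_ord0 !mxE !big_ord_recl !big_ord0 !mxE /=.
  rewrite !(mulr0, mulr1, addr0, add0r).
  by congr (rho _ _ * rho _ _ + rho _ _ * rho _ _); apply: val_inj.
apply/matrixP=> i j; rewrite X mxE.
have ord2_ind (P : 'I_2 -> Prop) : P 0 -> P 1 -> forall k, P k.
  move=> P0 P1 [[|[|k]] k2] //; first by rewrite (_ : Ordinal k2 = 0) //; apply: val_inj.
  by rewrite (_ : Ordinal k2 = 1) //; apply: val_inj.
move: i j; do 2!apply: (ord2_ind _); rewrite /=.
- by rewrite mulrC E2.
- by rewrite E addrC -addrA E2 addr0.
- by rewrite [_ 1 1 * _]mulrC E [_ 1 0 * _]mulrC -addrA E2 addr0.
- by rewrite mulrC E2.
Qed.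

Lemma V_self_dual : gm_iso (V hK) (dual (V hK)).
Proof.
have sdN : self_dual (nat_module K).
  apply: (@self_dual_form (nat_module K) J2) => // s; apply: self_dual_J2.
  by have /eqP := SL2_det s; rewrite det2 subr_eq => /eqP.
have sdS : self_dual (sq_module hK).
  apply: (@self_dual_form (sq_module hK) J2) => // s; apply: self_dual_J2.
  rewrite !mxE -!exprMn; have /eqP := SL2_det s; rewrite det2 subr_eq => /eqP ->.
  by have [_ /eqP h] := andP hK; rewrite sqrrD expr1n -[_ *+ 2]mulr_natr h mulr0 addr0.
have [A [B [AB BA H]]] : self_dual (Vstar hK) by do !apply: self_dual_dsum.
by exists A, B; split=> // s; rewrite dualK; apply: H.
Qed.

End Action.

(** * Finiteness over the parameters *)

Fixpoint independent (S T : comNzRingType) (psi : {rmorphism S -> T}) (e : seq T) : Prop :=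
  if e is x :: e' then
    (forall s, gspan psi e' (psi s * x) -> s = 0) /\ independent psi e'
  else True.

Section CommonDenominator.
Variables (K : fieldType) (n : nat) (T : idomainType) (psi : {rmorphism {mpoly K[n]} -> T}).
Hypothesis psi_inj : injective psi.

Let psi0 s : psi s = 0 -> s = 0.
Proof. by move=> E; apply: psi_inj; rewrite rmorph0. Qed.

(** A maximal independent part of [E] is kept; each discarded element has a nonzero multiple in its
    span, and [d] is the product of these multipliers. *)
Lemma common_denominator (E : seq T) :
  exists2 e, independent psi e &
  exists2 d, d != 0 & forall f, gspan psi E f -> gspan psi e (psi d * f).
Proof.
elim: E => [|x E [e ie [d nd Hd]]].
  exists [::] => //; exists 1; first exact: oner_neq0.
  by move=> f /= ->; rewrite mulr0.
case: (classic (exists2 s, s != 0 & gspan psi e (psi s * x))) => [[s ns Hs]|nx].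
  exists e => //; exists (d * s); first by rewrite mulf_neq0.
  move=> f /= [c /Hd Hf]; rewrite -(subrK (psi c * x) f) mulrDr rmorphM; apply: gspanD.
    by rewrite [psi d * psi s]mulrC -mulrA; apply: gspanM.
  rewrite (_ : _ * _ = psi (d * c) * (psi s * x)); first exact: gspanM.
  by rewrite rmorphM; ring.
exists (x :: e).
  by split=> // s Hs; apply/eqP/negbNE/negP => ns; case: nx; exists s.
exists d => // f /= [c /Hd Hf]; exists (d * c).
by rewrite rmorphM -mulrA -mulrBr.
Qed.

(** On a free module: the coordinates [c] of [a h] and [d] of [b h] satisfy [a d = b c], so [a]
    divides [c], and the quotient is the coordinate of [h]. *)
Lemma coprime_gspan (e : seq T) (a b : {mpoly K[n]}) (h : T) :
  a != 0 -> b != 0 -> (forall s t, a * s = b * t -> exists w, t = a * w) ->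
  independent psi e -> gspan psi e (psi a * h) -> gspan psi e (psi b * h) -> gspan psi e h.
Proof.
move=> na nb cop; elim: e h => [|x e IH] h /=.
  move=> _ /eqP; rewrite mulf_eq0 => /orP[/eqP/psi0/eqP|/eqP->//].
  by rewrite (negPf na).
move=> [ix ie] [c Hc] [d Hd].
have E : a * d = b * c.
  apply/eqP; rewrite -subr_eq0; apply/eqP/ix.
  suff -> : psi (a * d - b * c) * x =
     psi b * (psi a * h - psi c * x) - psi a * (psi b * h - psi d * x).
    by apply: gspanD; [exact: gspanM|apply/gspanN/gspanM].
  by rewrite rmorphB !rmorphM; ring.
have [w Ec] := cop _ _ E.
have Ed : d = b * w by apply: (mulfI na); rewrite E Ec; ring.
exists w; apply: IH => //.
  by rewrite mulrBr mulrA -rmorphM -Ec.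
by rewrite mulrBr mulrA -rmorphM -Ed.
Qed.

Lemma gspan_cancel (r : seq T) (d : {mpoly K[n]}) (f : T) : d != 0 ->
  gspan psi (map (fun x => psi d * x) r) (psi d * f) -> gspan psi r f.
Proof.
move=> nd; have nd' : psi d != 0 by apply: contra nd => /eqP/psi0->.
elim: r f => [|x r IH] f /=.
  by move/eqP; rewrite mulf_eq0 (negPf nd') => /eqP.
by case=> c; rewrite mulrCA -mulrBr => /IH H; exists c.
Qed.

(** Multiplied by a common denominator [d], the module [M] lands in a free module of finite rank:
    powers of [a] and of [b] carry it there, and [coprime_gspan] removes them. Noetherianity makes
    [d M] finitely generated, and [d] is cancelled. *)
Lemma fg_of_coprime_localizations (B : seq T) (M : T -> Prop) (a b : {mpoly K[n]}) :
  (forall k, a ^+ k != 0) -> (forall l, b ^+ l != 0) ->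
  (forall k l s t, a ^+ k * s = b ^+ l * t -> exists w, t = a ^+ k * w) ->
  submod psi M ->
  (forall f, M f -> exists k, gspan psi B (psi (a ^+ k) * f)) ->
  (forall f, M f -> exists l, gspan psi B (psi (b ^+ l) * f)) ->
  exists r, (forall x, x \in r -> M x) /\ forall f, M f -> gspan psi r f.
Proof.
move=> na nb cop [M0 MD MM] Ha Hb.
have [e ie [d nd Hd]] := common_denominator B.
pose M' g := exists2 f, M f & g = psi d * f.
have sM' : submod psi M'.
  split=> [|f g [f' Mf ->] [g' Mg ->]|s f [f' Mf ->]].
  - by exists 0 => //; rewrite mulr0.
  - by exists (f' + g'); rewrite ?mulrDr //; apply: MD.
  - by exists (psi s * f'); rewrite 1?mulrCA //; apply: MM.
have sub g : M' g -> gspan psi e g.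
  move=> [f Mf ->]; have [k /Hd Hk] := Ha _ Mf; have [l /Hd Hl] := Hb _ Mf.
  by apply: (coprime_gspan (na k) (nb l) (cop k l)) => //; rewrite mulrCA.
have [B' [B'M B'g]] := noetherian_submod_fg (@mpoly_noetherian K n) sM' sub.
have [r Er Hr] : exists2 r, B' = map (fun x => psi d * x) r & forall x, x \in r -> M x.
  elim: B' B'M {B'g} => [|x B' IH] H; first by exists [::].
  have [|r -> Hr] := IH; first by move=> y yB; apply: H; rewrite inE yB orbT.
  have [f Mf ->] := H x (mem_head _ _).
  by exists (f :: r) => // y; rewrite inE => /predU1P[->|/Hr].
exists r; split=> // f Mf; apply: (gspan_cancel nd); rewrite -Er.
by apply: B'g; exists f.
Qed.

End CommonDenominator.

(** * The algebra generated by the [FF] and [GG] is finite over [theta] *)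

Section Finiteness.
Variables (K : closedFieldType) (hK : 2%N \in [pchar K]).
Notation T := {mpoly K[10]}.
Notation FF := (@FF K).
Notation GG := (@GG K).
Notation theta := (@theta K).

Lemma plucker i j k l : FF i k * FF j l = FF i j * FF k l + FF j k * FF i l.
Proof.
apply: (eq_char2 hK (z := - (xx K i * xx K k * yy K j * yy K l)
  - xx K j * xx K l * yy K i * yy K k)).
by rewrite /FF; ring.
Qed.

(** The square of the Pluecker relation with fourth index [0], [GG i] playing the role of the square
    of [FF i 0]. *)
Lemma plucker_sq i j k :
  FF i k ^+ 2 * GG j = FF i j ^+ 2 * GG k + FF j k ^+ 2 * GG i.
Proof.
pose xs a : T := xx K a ^+ 2; pose ys a : T := yy K a ^+ 2; pose c a b := xx K a * yy K b * xx K b * yy K a.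
pose W := yy K 0 * (xs i * xs k * ys j + xs j * xs k * ys i + xs i * xs j * ys k)
  + xx K 0 * (ys i * ys k * xs j + ys j * ys k * xs i + ys i * ys j * xs k)
  + c i j * GG k + c j k * GG i + c i k * GG j.
apply: (eq_char2 hK (z := W - (FF i j ^+ 2 * GG k + FF j k ^+ 2 * GG i))).
by rewrite /W /c /xs /ys /FF /GG; ring.
Qed.

(** The first five entries are also the first five of [theta]; [gen_wt] lists the degrees in the
    same order. *)
Definition gens : 10.-tuple T :=
  [tuple FF 1 2; FF 2 3; FF 3 4; GG 1; GG 4; FF 1 3; FF 1 4; FF 2 4; GG 2; GG 3].

Definition gen_wt (i : nat) := nth 0%N [:: 2; 2; 2; 3; 3; 2; 2; 2; 3; 3] i.

Definition wt (m : 'X_{1..10}) := (\sum_i m i * gen_wt i)%N.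

Lemma wtD m m' : wt (m + m')%MM = (wt m + wt m')%N.
Proof. by rewrite /wt -big_split; apply: eq_bigr => i _; rewrite mnmDE mulnDl. Qed.

Lemma wt0 : wt 0%MM = 0%N.
Proof. by rewrite /wt big1 // => i _; rewrite mnm0E. Qed.

Lemma wtU i k : wt (U_(i) *+ k)%MM = (k * gen_wt i)%N.
Proof.
rewrite /wt (bigD1 i) //= big1 ?addn0 ?mulmnE ?mnm1E ?eqxx ?mul1n // => j ji.
by rewrite mulmnE mnm1E eq_sym (negPf ji).
Qed.

Definition gen_alg (n : nat) (f : T) :=
  exists2 P : {mpoly K[10]}, f = P \mPo gens & forall m, m \in msupp P -> (wt m <= n)%N.

Lemma gen_alg_le n n' f : (n <= n')%N -> gen_alg n f -> gen_alg n' f.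
Proof. by move=> le [P E H]; exists P => // m /H /leq_trans; apply. Qed.

Lemma gen_algX m : gen_alg (wt m) ('X_[m] \mPo gens).
Proof. by exists 'X_[m] => // m'; rewrite msuppX inE => /eqP->. Qed.

Lemma gen_algC n c : gen_alg n c%:MP.
Proof.
exists c%:MP => [|m]; first by rewrite comp_mpolyC.
rewrite msuppC; case: ifP => // _; rewrite inE => /eqP->.
by rewrite wt0.
Qed.

Lemma gen_alg_gen i : (i < 10)%N -> gen_alg (gen_wt i) gens`_i.
Proof.
move=> lt; have := gen_algX (U_(Ordinal lt) *+ 1)%MM.
by rewrite wtU mul1n mulm1n comp_mpolyXU.
Qed.

Lemma gen_algD n f g : gen_alg n f -> gen_alg n g -> gen_alg n (f + g).
Proof.
move=> [P -> HP] [Q -> HQ]; exists (P + Q); first by rewrite rmorphD.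
by move=> m /msuppD_le; rewrite mem_cat => /orP[/HP|/HQ].
Qed.

Lemma gen_algM n k f g : gen_alg n f -> gen_alg k g -> gen_alg (n + k) (f * g).
Proof.
move=> [P -> HP] [Q -> HQ]; exists (P * Q); first by rewrite rmorphM.
move=> m /msuppM_le /allpairsP[[m1 m2] /= [/HP h1 /HQ h2 ->]].
by rewrite wtD leq_add.
Qed.

Lemma gen_algXn n f k : gen_alg n f -> gen_alg (k * n) (f ^+ k).
Proof.
move=> H; elim: k => [|k IH]; first by rewrite mul0n expr0 -(mpolyC1 10 K); apply: gen_algC.
by rewrite exprS mulSn; apply: gen_algM.
Qed.

(* n bounds the weights of the cofactors, not of f: the induction in gen_alg_fg needs them smaller. *)
Definition theta_ideal (n : nat) (f : T) :=
  exists2 c : 'I_7 -> T, forall i, gen_alg n (c i) & f = \sum_(i < 7) theta`_i * c i.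

Lemma theta_ideal_le n n' f : (n <= n')%N -> theta_ideal n f -> theta_ideal n' f.
Proof. by move=> le [c H ->]; exists c => // i; apply: gen_alg_le le _. Qed.

Lemma theta_ideal_gen n c (i : nat) : (i < 7)%N -> gen_alg n c -> theta_ideal n (theta`_i * c).
Proof.
move=> i7 Hc; exists (fun j : 'I_7 => if j == i :> nat then c else 0) => [j|].
  by case: ifP => // _; rewrite -(rmorph0 (@mpolyC 10 K)); apply: gen_algC.
rewrite (bigD1 (Ordinal i7)) //= eqxx big1 ?addr0 // => j.
by rewrite -val_eqE /= => /negPf->; rewrite mulr0.
Qed.

Lemma theta_idealD n f g : theta_ideal n f -> theta_ideal n g -> theta_ideal n (f + g).
Proof.
move=> [c Hc ->] [d Hd ->]; exists (fun i => c i + d i) => [i|]; first exact: gen_algD.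
by rewrite -big_split; apply: eq_bigr => i _; rewrite mulrDr.
Qed.

Lemma theta_idealM n k f g : theta_ideal n f -> gen_alg k g -> theta_ideal (n + k) (f * g).
Proof.
move=> [c Hc ->] Hg; exists (fun i => c i * g) => [i|]; first exact: gen_algM.
by rewrite mulr_suml; apply: eq_bigr => i _; rewrite mulrA.
Qed.

Let B12 : gen_alg 2 (FF 1 2). Proof. exact: (@gen_alg_gen 0). Qed.
Let B23 : gen_alg 2 (FF 2 3). Proof. exact: (@gen_alg_gen 1). Qed.
Let B34 : gen_alg 2 (FF 3 4). Proof. exact: (@gen_alg_gen 2). Qed.
Let B1 : gen_alg 3 (GG 1). Proof. exact: (@gen_alg_gen 3). Qed.
Let B4 : gen_alg 3 (GG 4). Proof. exact: (@gen_alg_gen 4). Qed.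
Let B13 : gen_alg 2 (FF 1 3). Proof. exact: (@gen_alg_gen 5). Qed.
Let B14 : gen_alg 2 (FF 1 4). Proof. exact: (@gen_alg_gen 6). Qed.
Let B24 : gen_alg 2 (FF 2 4). Proof. exact: (@gen_alg_gen 7). Qed.
Let B2 : gen_alg 3 (GG 2). Proof. exact: (@gen_alg_gen 8). Qed.
Let B3 : gen_alg 3 (GG 3). Proof. exact: (@gen_alg_gen 9). Qed.

(** From here to [gens_pow16], polynomials in the generators outside [theta] are shown to lie in the
    ideal of [theta], ending with a power of each generator. *)
Let Z2413 : theta_ideal 2 (FF 1 3 * FF 2 4).
Proof.
rewrite (plucker 1 2 3 4); apply: theta_idealD.
  exact: (@theta_ideal_gen 2 _ 0).
exact: (@theta_ideal_gen 2 _ 1).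
Qed.

Let Z132 : theta_ideal 5 (FF 1 3 ^+ 2 * GG 2).
Proof.
rewrite plucker_sq expr2 -mulrA [_ * GG 1]mulrC; apply: theta_idealD.
  by apply: (@theta_ideal_gen _ _ 0) => //; apply: (gen_algM B12 B3).
by apply: (@theta_ideal_gen _ _ 3) => //; apply: gen_alg_le (gen_algXn 2 B23).
Qed.

Let Z142 : theta_ideal 5 (FF 1 4 ^+ 2 * GG 2).
Proof.
rewrite plucker_sq expr2 -mulrA [_ * GG 1]mulrC; apply: theta_idealD.
  by apply: (@theta_ideal_gen _ _ 0) => //; apply: (gen_algM B12 B4).
by apply: (@theta_ideal_gen _ _ 3) => //; apply: gen_alg_le (gen_algXn 2 B24).
Qed.

Let Z143 : theta_ideal 5 (FF 1 4 ^+ 2 * GG 3).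
Proof.
rewrite plucker_sq addrC [FF 3 4 ^+ 2]expr2 -mulrA [_ * GG 4]mulrC; apply: theta_idealD.
  by apply: (@theta_ideal_gen _ _ 2) => //; apply: (gen_algM B34 B1).
by apply: (@theta_ideal_gen _ _ 4) => //; apply: gen_alg_le (gen_algXn 2 B13).
Qed.

Let Z243 : theta_ideal 5 (FF 2 4 ^+ 2 * GG 3).
Proof.
rewrite plucker_sq addrC [FF 3 4 ^+ 2]expr2 -mulrA [_ * GG 4]mulrC; apply: theta_idealD.
  by apply: (@theta_ideal_gen _ _ 2) => //; apply: (gen_algM B34 B2).
by apply: (@theta_ideal_gen _ _ 4) => //; apply: gen_alg_le (gen_algXn 2 B23).
Qed.

(** Modulo [theta], the square of [g] equals [b^3 + d^3], so a relation for [a^2 g] becomes one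
    among the [FF] alone. *)
Let ZA (a b d g : T) t : gen_alg 2 a -> gen_alg 3 g -> (t < 7)%N ->
  theta`_t = g ^+ 2 + (b ^+ 3 + d ^+ 3) -> theta_ideal 5 (a ^+ 2 * g) ->
  theta_ideal 8 (a ^+ 2 * (b ^+ 3 + d ^+ 3)).
Proof.
move=> Ba Bg t7 Et Zag.
rewrite (_ : _ * _ = theta`_t * a ^+ 2 + (a ^+ 2 * g) * g).
  apply: theta_idealD; last exact: (theta_idealM Zag Bg).
  by apply: theta_ideal_gen => //; apply: gen_alg_le (gen_algXn 2 Ba).
apply: (eq_char2 hK (z := - (a ^+ 2 * g ^+ 2))); rewrite Et; ring.
Qed.

Let ZA1 : theta_ideal 8 (FF 1 3 ^+ 2 * (FF 1 3 ^+ 3 + FF 1 4 ^+ 3)).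
Proof. exact: (ZA (t := 5) B13 B2 isT erefl Z132). Qed.
Let ZA2 : theta_ideal 8 (FF 1 4 ^+ 2 * (FF 1 3 ^+ 3 + FF 1 4 ^+ 3)).
Proof. exact: (ZA (t := 5) B14 B2 isT erefl Z142). Qed.
Let ZA3 : theta_ideal 8 (FF 1 4 ^+ 2 * (FF 2 4 ^+ 3 + FF 1 4 ^+ 3)).
Proof. exact: (ZA (t := 6) B14 B3 isT erefl Z143). Qed.
Let ZA4 : theta_ideal 8 (FF 2 4 ^+ 2 * (FF 2 4 ^+ 3 + FF 1 4 ^+ 3)).
Proof. exact: (ZA (t := 6) B24 B3 isT erefl Z243). Qed.

(* Used for (a, b) = (f_13, f_24) and (f_24, f_13), with c = f_14. *)
Let ZB (a b c : T) : gen_alg 2 a -> gen_alg 2 b -> gen_alg 2 c ->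
  theta_ideal 2 (a * b) ->
  theta_ideal 8 (c ^+ 2 * (b ^+ 3 + c ^+ 3)) -> theta_ideal 10 (a * c ^+ 5).
Proof.
move=> Ba Bb Bc Zab Zcb.
rewrite (_ : _ * _ = c ^+ 2 * (b ^+ 3 + c ^+ 3) * a + a * b * (b ^+ 2 * c ^+ 2)).
  apply: theta_idealD; first exact: (theta_idealM Zcb Ba).
  exact: (theta_idealM Zab (gen_algM (gen_algXn 2 Bb) (gen_algXn 2 Bc))).
apply: (eq_char2 hK (z := - (a * b ^+ 3 * c ^+ 2))); ring.
Qed.

(** In characteristic [2], [a^8 = a^2 (a^3 + c^3)^2 + a^2 c^6], and the hypotheses cover both
    terms. *)
Let ZC (a c : T) : gen_alg 2 a -> gen_alg 2 c ->
  theta_ideal 8 (a ^+ 2 * (a ^+ 3 + c ^+ 3)) -> theta_ideal 10 (a * c ^+ 5) ->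
  theta_ideal 14 (a ^+ 8).
Proof.
move=> Ba Bc Z1 Z2.
rewrite (_ : _ ^+ _ = a ^+ 2 * (a ^+ 3 + c ^+ 3) * (a ^+ 3 + c ^+ 3) + a * c ^+ 5 * (a * c)).
  apply: theta_idealD; last exact: (theta_idealM Z2 (gen_algM Ba Bc)).
  exact: (theta_idealM Z1 (gen_algD (gen_algXn 3 Ba) (gen_algXn 3 Bc))).
apply: (eq_char2 hK (z := - (a ^+ 5 * c ^+ 3) - a ^+ 2 * c ^+ 6)); ring.
Qed.

Let Z13 : theta_ideal 14 (FF 1 3 ^+ 8).
Proof. exact: (ZC B13 B14 ZA1 (ZB B13 B24 B14 Z2413 ZA3)). Qed.

Let Z24 : theta_ideal 14 (FF 2 4 ^+ 8).
Proof.
apply: (ZC B24 B14 ZA4 (ZB B24 B13 B14 _ ZA2)).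
by rewrite mulrC; apply: Z2413.
Qed.

Let Z14 : theta_ideal 14 (FF 1 4 ^+ 8).
Proof.
have Z := ZB B13 B24 B14 Z2413 ZA3.
rewrite (_ : _ ^+ _ = FF 1 4 ^+ 2 * (FF 1 3 ^+ 3 + FF 1 4 ^+ 3) * FF 1 4 ^+ 3
  + FF 1 3 * FF 1 4 ^+ 5 * FF 1 3 ^+ 2).
  apply: theta_idealD; first exact: (theta_idealM ZA2 (gen_algXn 3 B14)).
  exact: (theta_idealM Z (gen_algXn 2 B13)).
apply: (eq_char2 hK (z := - (FF 1 3 ^+ 3 * FF 1 4 ^+ 5))); ring.
Qed.

(** By Frobenius the eighth power of the parameter is [g^16 + a^24 + b^24], and [a^8], [b^8] are
    already in the ideal. *)
Let ZG (g a b : T) t : gen_alg 3 g -> gen_alg 2 a -> gen_alg 2 b ->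
  theta_ideal 14 (a ^+ 8) -> theta_ideal 14 (b ^+ 8) -> (t < 7)%N ->
  theta`_t = g ^+ 2 + (a ^+ 3 + b ^+ 3) -> theta_ideal 46 (g ^+ 16).
Proof.
move=> Bg Ba Bb Za Zb t7 Et.
have Bt : gen_alg 6 theta`_t.
  rewrite Et; apply: gen_algD; first exact: (gen_algXn 2 Bg).
  exact: (gen_algD (gen_algXn 3 Ba) (gen_algXn 3 Bb)).
have sq (x y : T) : (x + y) ^+ 2 = x ^+ 2 + y ^+ 2.
  by apply: (eq_char2 hK (z := x * y)); ring.
have E8 : theta`_t ^+ 8 = g ^+ 16 + (a ^+ 24 + b ^+ 24).
  by rewrite Et (exprM _ 2 4) (exprM _ 2 2) !sq -!exprM.
rewrite (_ : g ^+ 16 = theta`_t * theta`_t ^+ 7 + (a ^+ 8 * a ^+ 16 + b ^+ 8 * b ^+ 16)).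
  apply: theta_idealD.
    by apply: theta_ideal_gen => //; apply: gen_alg_le (gen_algXn 7 Bt).
  by apply: theta_idealD; [exact: (theta_idealM Za (gen_algXn 16 Ba))|
    exact: (theta_idealM Zb (gen_algXn 16 Bb))].
rewrite -exprS E8 -!exprD; apply: (eq_char2 hK (z := - (a ^+ 24 + b ^+ 24))).
by ring.
Qed.

(** The exponent [16] suits all ten generators. The predecessor in the bound records that the
    cofactors have strictly smaller weight than the power. *)
Lemma gens_pow16 (i : 'I_10) : theta_ideal (16 * gen_wt i).-1 (tnth gens i ^+ 16).
Proof.
have Zt (j : nat) f : (j < 7)%N -> f = theta`_j -> gen_alg (gen_wt i) f -> tnth gens i = f ->
    theta_ideal (16 * gen_wt i).-1 (tnth gens i ^+ 16).
  move=> j7 Ef Bf ->; rewrite exprS {1}Ef; apply: theta_ideal_gen => //.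
  apply: gen_alg_le (gen_algXn 15 Bf).
  by move: (nat_of_ord i) (ltn_ord i) => k; do 10?[case: k => [|k] //].
have ZF f : gen_wt i = 2%N -> gen_alg 2 f -> theta_ideal 14 (f ^+ 8) -> tnth gens i = f ->
    theta_ideal (16 * gen_wt i).-1 (tnth gens i ^+ 16).
  move=> -> Bf Zf ->; rewrite -[16%N]/(8 + 8)%N exprD.
  exact: theta_ideal_le (theta_idealM Zf (gen_algXn 8 Bf)).
have ZG' f : gen_wt i = 3%N -> theta_ideal 46 (f ^+ 16) -> tnth gens i = f ->
    theta_ideal (16 * gen_wt i).-1 (tnth gens i ^+ 16).
  by move=> -> Zf ->; apply: theta_ideal_le Zf.
move: Zt ZF ZG'; rewrite (tnth_nth 0); move: (nat_of_ord i) (ltn_ord i) => k k10 Zt ZF ZG'.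
case: k => [|[|[|[|[|[|[|[|[|[|k]]]]]]]]]] in k10 Zt ZF ZG' *; last by discriminate k10.
- exact: (Zt 0%N _ isT erefl B12 erefl).
- exact: (Zt 1%N _ isT erefl B23 erefl).
- exact: (Zt 2%N _ isT erefl B34 erefl).
- exact: (Zt 3%N _ isT erefl B1 erefl).
- exact: (Zt 4%N _ isT erefl B4 erefl).
- exact: (ZF _ erefl B13 Z13 erefl).
- exact: (ZF _ erefl B14 Z14 erefl).
- exact: (ZF _ erefl B24 Z24 erefl).
- exact: (ZG' _ erefl (ZG (t := 5) B2 B13 B14 Z13 Z14 isT erefl) erefl).
- exact: (ZG' _ erefl (ZG (t := 6) B3 B24 B14 Z24 Z14 isT erefl) erefl).
Qed.

Definition phi : {mpoly K[size theta]} -> T := comp_mpoly (in_tuple theta).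
HB.instance Definition _ := GRing.RMorphism.on phi.

Lemma phiX (i : 'I_(size theta)) : phi 'X_i = theta`_i.
Proof. by rewrite /phi comp_mpolyXU. Qed.

Lemma phi_inj : injective phi.
Proof.
apply: raddf_inj => P; exact: (@theta_alg_independent K P).
Qed.

Lemma split_gen (m : 'X_{1..10}) (i : 'I_10) k : (k <= m i)%N ->
  'X_[m] \mPo gens = tnth gens i ^+ k * ('X_[m - U_(i) *+ k] \mPo gens) /\
  wt m = (k * gen_wt i + wt (m - U_(i) *+ k)%MM)%N.
Proof.
move=> lek; have le : (U_(i) *+ k <= m)%MM.
  apply/mnm_lepP => j; rewrite mulmnE mnm1E; case: eqP => [<-|_]; first by rewrite mul1n.
  by rewrite mul0n.
split; last by rewrite -{1}(submK le) wtD wtU addnC.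
rewrite -{1}(submK le) mpolyXD rmorphM mulrC; congr (_ * _).
by rewrite -mpolyXn rmorphXn /= comp_mpolyXU -tnth_nth.
Qed.

(** The monomials with all exponents below [16] suffice, by induction on weight: a larger exponent
    allows a rewriting into multiples of [theta] with cofactors of smaller weight. *)
Lemma gen_alg_fg : exists E : seq T, forall n f, gen_alg n f -> gspan phi E f.
Proof.
pose mn (a : {ffun 'I_10 -> 'I_16}) : 'X_{1..10} := [multinom nat_of_ord (a i) | i < 10].
have [E HE] : exists E : seq T, forall m : 'X_{1..10}, (forall i, m i < 16)%N ->
    'X_[m] \mPo gens \in E.
  exists [seq 'X_[mn a] \mPo gens | a <- enum {: {ffun 'I_10 -> 'I_16}}] => m m16.
  apply/mapP; exists [ffun i => Ordinal (m16 i)]; first by rewrite mem_enum.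
  by congr ('X_[_] \mPo _); apply/mnmP=> i; rewrite mnmE ffunE.
exists E; have red n : (forall m, (wt m <= n)%N -> gspan phi E ('X_[m] \mPo gens)) ->
    forall f, gen_alg n f -> gspan phi E f.
  move=> H f [P -> HP]; rewrite comp_mpolyEX big_seq; apply: gspan_sum => m /HP /H Hm.
  rewrite -mul_mpolyC (_ : _%:MP = phi (P@_m)%:MP); first by apply: gspanM.
  by rewrite /phi comp_mpolyC.
move=> n; apply: (red n); elim: n => [|n IH] m wm.
  apply/gspan_mem/HE => i; move: wm; rewrite leqn0 /wt sum_nat_eq0 => /forallP /(_ i) /=.
  rewrite muln_eq0 => /orP[/eqP->//|].
  move: (nat_of_ord i) (ltn_ord i) => k; do 10?[case: k => [|k] //].
case: (pickP (fun i => 16 <= m i)%N) => [i i16|H]; last first.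
  by apply/gspan_mem/HE => i; rewrite ltnNge H.
have [Em Ew] := split_gen i16.
have w0 : (0 < 16 * gen_wt i)%N.
  by move: (nat_of_ord i) (ltn_ord i) => k; do 10?[case: k => [|k] //].
rewrite Em; have [c Hc ->] := theta_idealM (gens_pow16 i) (gen_algX (m - U_(i) *+ 16)).
apply: gspan_sum => j _; rewrite -(phiX j); apply: gspanM.
apply: (red _ IH); apply: gen_alg_le (Hc j).
by move: wm w0; rewrite Ew; move: (16 * _)%N => k; case: k => //= k; rewrite addSn ltnS.
Qed.

End Finiteness.

(** * The invariant ring is finite over theta *)

Lemma mpoly_alg_ind (K : fieldType) (n : nat) (Q : {mpoly K[n]} -> Prop) :
  (forall c, Q c%:MP) -> (forall i, Q 'X_i) ->
  (forall f g, Q f -> Q g -> Q (f + g)) -> (forall f g, Q f -> Q g -> Q (f * g)) ->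
  forall f, Q f.
Proof.
move=> QC QX QD QM f; rewrite (mpolyE f).
elim/big_rec: _ => [|m g _ Qg]; first exact: (QC 0).
apply: (QD _ _) => //; rewrite -mul_mpolyC; apply: (QM _ _) => //; rewrite mpolyXE_id.
elim/big_rec: _ => [|i h _ Qh]; first exact: (QC 1).
apply: (QM _ _) => //; elim: (m i) => [|k IH]; first exact: (QC 1).
by rewrite exprS; apply: (QM _ _).
Qed.

Section Invariants.
Variables (K : closedFieldType) (hK : 2%N \in [pchar K]).
Notation T := {mpoly K[10]}.
Notation FF := (@FF K).
Notation GG := (@GG K).
Notation theta := (@theta K).
Notation sl2_act := (@sl2_act K hK).

Lemma FF_sym i j : FF i j = FF j i. Proof. exact: addrC. Qed.

Lemma FF_gen i j : (0 < i < 5)%N -> (0 < j < 5)%N -> gen_alg 2 (FF i j).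
Proof.
have ii a : gen_alg 2 (FF a a).
  rewrite /FF char2 // -(rmorph0 (@mpolyC 10 K)); exact: gen_algC.
have B12 : gen_alg 2 (FF 1 2) := @gen_alg_gen K 0 isT.
have B23 : gen_alg 2 (FF 2 3) := @gen_alg_gen K 1 isT.
have B34 : gen_alg 2 (FF 3 4) := @gen_alg_gen K 2 isT.
have B13 : gen_alg 2 (FF 1 3) := @gen_alg_gen K 5 isT.
have B14 : gen_alg 2 (FF 1 4) := @gen_alg_gen K 6 isT.
have B24 : gen_alg 2 (FF 2 4) := @gen_alg_gen K 7 isT.
move=> hi hj; have /or4P hi' : [|| i == 1%N, i == 2%N, i == 3%N | i == 4%N] by lia.
have /or4P hj' : [|| j == 1%N, j == 2%N, j == 3%N | j == 4%N] by lia.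
case: hi' => /eqP -> {i hi}; case: hj' => /eqP -> {j hj}.
all: [> exact: ii|exact: B12|exact: B13|exact: B14|rewrite FF_sym; exact: B12|exact: ii|exact: B23|exact: B24
  |rewrite FF_sym; exact: B13|rewrite FF_sym; exact: B23|exact: ii|exact: B34
  |rewrite FF_sym; exact: B14|rewrite FF_sym; exact: B24|rewrite FF_sym; exact: B34|exact: ii].
Qed.

Lemma GG_gen i : (0 < i < 5)%N -> gen_alg 3 (GG i).
Proof.
have B1 : gen_alg 3 (GG 1) := @gen_alg_gen K 3 isT.
have B2 : gen_alg 3 (GG 2) := @gen_alg_gen K 8 isT.
have B3 : gen_alg 3 (GG 3) := @gen_alg_gen K 9 isT.
have B4 : gen_alg 3 (GG 4) := @gen_alg_gen K 4 isT.
move=> hi; have /or4P hi' : [|| i == 1%N, i == 2%N, i == 3%N | i == 4%N] by lia.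
case: hi' => /eqP -> {i hi}.
all: [> exact: B1|exact: B2|exact: B3|exact: B4].
Qed.

(* Wherever D = f_ij is nonzero, the element [y_j, y_i/D; x_j, x_i/D] of SL_2 sends v_k to
   (f_jk, f_ik/D) and (p, q) to (g_j, g_i/D^2); so D^k f is a polynomial in the f's and g's. *)
Lemma invariant_localize i j f : (0 < i < 5)%N -> (0 < j < 5)%N -> FF i j != 0 ->
  (forall s, sl2_act s f = f) -> exists k n, gen_alg n (FF i j ^+ k * f).
Proof.
move=> hi hj nD inv; set D := FF i j in nD *.
pose x k (w : 'I_10 -> K) := w (inord k.*2); pose y k (w : 'I_10 -> K) := w (inord k.*2.+1).
have FFe a b w : (FF a b).@[w] = x a w * y b w + x b w * y a w.
  by rewrite /FF mevalD !mevalM !mevalXU.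
have GGe a w : (GG a).@[w] = x a w ^+ 2 * y 0%N w + y a w ^+ 2 * x 0%N w.
  by rewrite /GG mevalD !mevalM !mevalXU !expr2.
have E2 (c : K) : c + c = 0 by have [_ /eqP h] := andP hK; rewrite -mulr2n -mulr_natr h mulr0.
have exs w : exists s : SL2 K, D.@[w] != 0 ->
   [/\ SL2val s 0 0 = y j w, SL2val s 0 1 = y i w / D.@[w],
       SL2val s 1 0 = x j w & SL2val s 1 1 = x i w / D.@[w]].
  (* Where [D] vanishes nothing is claimed, and the identity serves as a default. *)
  case: (eqVneq D.@[w] 0) => [_|nDw]; first by exists 1%g.
  have [|s Hs] := @exists_SL2 K (y j w) (y i w / D.@[w]) (x j w) (x i w / D.@[w]); last by exists s.
  rewrite mulrA [y i w / _ * _]mulrAC -mulrBl.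
  rewrite (_ : _ - _ = D.@[w]) ?divff // /D FFe mulrC; congr (_ + _).
  by rewrite [x j w * _]mulrC; apply/eqP; rewrite eq_sym -subr_eq0 opprK E2.
pose sig w := sval (constructive_indefinite_description _ (exs w)).
have sigE w : D.@[w] != 0 ->
   [/\ SL2val (sig w) 0 0 = y j w, SL2val (sig w) 0 1 = y i w / D.@[w],
       SL2val (sig w) 1 0 = x j w & SL2val (sig w) 1 1 = x i w / D.@[w]].
  exact: (svalP (constructive_indefinite_description _ (exs w))).
pose tau w idx := (sl2_act (sig w) 'X_idx).@[w].
(* Away from the zeros of [D], evaluating [g] at the moved point and clearing denominators gives an
   element of the algebra. This holds for the variables and is stable under sums and products. *)
pose Q g := exists k n, exists2 F, gen_alg n F & forall w, D.@[w] != 0 ->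
   (D ^+ k).@[w] * g.@[tau w] = F.@[w].
have : Q f.
  apply: mpoly_alg_ind => [c|idx|g h|g h].
  - exists 0%N, 0%N, c%:MP; first exact: gen_algC.
    by move=> w _; rewrite expr0 meval1 mul1r !mevalC.
  - move: idx; apply: idx_ind => k k5.
    case: k k5 => [|k] k5.
      split.
        exists 0%N, 3%N, (GG j); first exact: GG_gen.
        move=> w nDw; rewrite expr0 meval1 mul1r mevalXU /tau -[X in sl2_act _ X]/(xx K 0) (act_sq hK _).1.
        have [-> _ -> _] := sigE w nDw.
        by rewrite mevalD !mevalM !mevalC !mevalXU GGe addrC.
      exists 2%N, 3%N, (GG i); first exact: GG_gen.
      move=> w nDw; rewrite mevalXU /tau -[X in sl2_act _ X]/(yy K 0) (act_sq hK _).2.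
      have [_ -> _ ->] := sigE w nDw.
      rewrite mevalD !mevalM !mevalC !mevalXU GGe -/(x 0%N w) -/(y 0%N w); by field.
    have k15 : (0 < k.+1 < 5)%N by [].
    split.
      exists 0%N, 2%N, (FF j k.+1); first exact: FF_gen.
      move=> w nDw; rewrite expr0 meval1 mul1r mevalXU /tau -[X in sl2_act _ X]/(xx K k.+1).
      rewrite (act_nat hK _ k15).1; have [-> _ -> _] := sigE w nDw.
      by rewrite mevalD !mevalM !mevalC !mevalXU FFe addrC [_ * x k.+1 w]mulrC.
    exists 1%N, 2%N, (FF i k.+1); first exact: FF_gen.
    move=> w nDw; rewrite mevalXU /tau -[X in sl2_act _ X]/(yy K k.+1).
    rewrite (act_nat hK _ k15).2; have [_ -> _ ->] := sigE w nDw.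
    rewrite [X in _ * X = _]mevalD [X in _ * (X + _)]mevalM [X in _ * (_ + X)]mevalM.
    rewrite !mevalC !mevalXU FFe expr1 -/(x k.+1 w) -/(y k.+1 w); by field.
  - move=> [k [n [F HF EF]]] [l [m [G HG EG]]].
    exists (k + l)%N, (2 * l + n + (2 * k + m))%N, (D ^+ l * F + D ^+ k * G).
      apply: gen_algD; [apply: (@gen_alg_le _ (l * 2 + n)); first by lia|
         apply: (@gen_alg_le _ (k * 2 + m)); first by lia];
      by apply: gen_algM => //; apply: gen_algXn; apply: FF_gen.
    move=> w nDw; rewrite !mevalD !mevalM -(EF w nDw) -(EG w nDw) exprD mevalM; ring.
  - move=> [k [n [F HF EF]]] [l [m [G HG EG]]].
    exists (k + l)%N, (n + m)%N, (F * G); first exact: gen_algM.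
    move=> w nDw; rewrite !mevalM -(EF w nDw) -(EG w nDw) exprD mevalM; ring.
case=> k [n [F HF EF]]; exists k, n.
suff -> : D ^+ k * f = F by [].
apply/eqP; rewrite -subr_eq0; apply: contraT => nz.
(* The extra factor [D] confines the comparison to points where [D] is nonzero; there the two sides
   agree by invariance of [f]. *)
have [|w] := @mpoly_nonvanishing K 10 (D * (D ^+ k * f - F)); first by rewrite mulf_neq0.
rewrite mevalM mulf_eq0 negb_or mevalB => /andP[nDw /negP[]].
rewrite subr_eq0 -(EF w nDw) mevalM -{1}(inv (sig w)) act_eval.
exact/eqP.
Qed.

Definition sl2_invariant (f : T) := forall s, sl2_act s f = f.

Lemma invariantC c : sl2_invariant c%:MP.
Proof. by move=> s; rewrite actC. Qed.

Lemma invariantD f g : sl2_invariant f -> sl2_invariant g -> sl2_invariant (f + g).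
Proof. by move=> If Ig s; rewrite rmorphD /= If Ig. Qed.

Lemma invariantN f : sl2_invariant f -> sl2_invariant (- f).
Proof. by move=> If s; rewrite rmorphN /= If. Qed.

Lemma invariantM f g : sl2_invariant f -> sl2_invariant g -> sl2_invariant (f * g).
Proof. by move=> If Ig s; rewrite rmorphM /= If Ig. Qed.

Lemma invariantX f k : sl2_invariant f -> sl2_invariant (f ^+ k).
Proof. by move=> If s; rewrite rmorphXn /= If. Qed.

Lemma invariant_FF i j : (0 < i < 5)%N -> (0 < j < 5)%N -> sl2_invariant (FF i j).
Proof. by move=> hi hj s; apply: act_FF. Qed.

Lemma invariant_GG i : (0 < i < 5)%N -> sl2_invariant (GG i).
Proof. by move=> hi s; apply: act_GG. Qed.

Lemma invariant_theta_sum i a b c d : (0 < i < 5)%N -> (0 < a < 5)%N -> (0 < b < 5)%N ->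
  (0 < c < 5)%N -> (0 < d < 5)%N -> sl2_invariant (theta_sum K i a b c d).
Proof.
move=> *; apply: invariantD; first exact/invariantX/invariant_GG.
by apply: invariantD; apply/invariantX/invariant_FF.
Qed.

Lemma invariant_theta f : f \in theta -> sl2_invariant f.
Proof.
rewrite !inE => /or4P[/eqP->|/eqP->|/eqP->|/or4P[/eqP->|/eqP->|/eqP->|/eqP->]].
all: [> exact: invariant_FF|exact: invariant_FF|exact: invariant_FF|exact: invariant_GG|exact: invariant_GG
  |exact: invariant_theta_sum|exact: invariant_theta_sum].
Qed.

Lemma sl2_invariant_comp n (z : n.-tuple T) (P : {mpoly K[n]}) :
  (forall i, sl2_invariant (tnth z i)) -> sl2_invariant (P \mPo z).
Proof.
move=> Iz s.
apply: (mpoly_rmorph_ext (h1 := sl2_act s \o comp_mpoly z) (h2 := comp_mpoly z)) => [c|i] /=.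
  by rewrite comp_mpolyC actC.
by rewrite comp_mpolyXU -tnth_nth Iz.
Qed.

Lemma FF_homog i j : FF i j \is 2.-homog.
Proof.
rewrite /FF !xxE !yyE -!mpolyXD; apply: dhomogD;
by rewrite dhomogX /= mdegD !mdeg_ee.
Qed.

Lemma GG_homog i : GG i \is 3.-homog.
Proof.
rewrite /GG !xxE !yyE !mpolyXn -!mpolyXD; apply: dhomogD;
by rewrite dhomogX /= mdegD mdegMn !mdeg_ee.
Qed.

Lemma theta_sum_homog i a b c d : theta_sum K i a b c d \is 6.-homog.
Proof.
rewrite /theta_sum; apply: dhomogD; first exact: (dhomogMn 2 (GG_homog i)).
by apply: dhomogD; [exact: (dhomogMn 3 (FF_homog a b))|exact: (dhomogMn 3 (FF_homog c d))].
Qed.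

Lemma theta_homog f : f \in theta -> exists d : nat, f \is d.-homog.
Proof.
rewrite !inE => /or4P[/eqP->|/eqP->|/eqP->|/or4P[/eqP->|/eqP->|/eqP->|/eqP->]].
all: [> exists 2%N; exact: FF_homog|exists 2%N; exact: FF_homog|exists 2%N; exact: FF_homog
  |exists 3%N; exact: GG_homog|exists 3%N; exact: GG_homog
  |exists 6%N; exact: theta_sum_homog|exists 6%N; exact: theta_sum_homog].
Qed.

Lemma X_pow_coprime (n : nat) (i j : 'I_n) k l (s t : {mpoly K[n]}) : i != j ->
  'X_i ^+ k * s = 'X_j ^+ l * t -> exists w, t = 'X_i ^+ k * w.
Proof.
have nX a m : 'X_a ^+ m != 0 :> {mpoly K[n]}.
  by rewrite expf_neq0 // -msize_poly_eq0 msizeX.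
move=> ij; apply: coprime_lead_dvd => // a.
rewrite !mpolyXn !mleadXm !mulmnE !mnm1E.
by case: (eqVneq i a) => [<-|]; [right; rewrite eq_sym (negPf ij)|left].
Qed.

Lemma invariants_fg :
  exists r, (forall x, x \in r -> sl2_invariant x) /\ forall f, sl2_invariant f -> gspan (@phi K) r f.
Proof.
have [E HE] := gen_alg_fg hK.

(* Positions of [FF 1 2] and [FF 3 4] in [theta]: as distinct variables of the parameter ring they
   have coprime powers. *)
pose a : 'I_(size theta) := (Ordinal (isT : 0 < 7)%N).
pose b : 'I_(size theta) := (Ordinal (isT : 2 < 7)%N).
have nX (i : 'I_(size theta)) m : 'X_i ^+ m != 0 :> {mpoly K[size theta]}.
  by rewrite expf_neq0 // -msize_poly_eq0 msizeX.
have loc (i : 'I_(size theta)) j k f : (0 < j)%N -> (j < k < 5)%N -> theta`_i = FF j k -> sl2_invariant f ->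
    exists m, gspan (@phi K) E (phi ('X_i ^+ m) * f).
  move=> j0 jk Ei If; have [||m [n Hm]] := @invariant_localize j k f _ _ (FF_neq0 K j0 jk) If.
  - by lia.
  - by lia.
  exists m; rewrite rmorphXn /= phiX Ei; exact: HE Hm.
apply: (@fg_of_coprime_localizations K _ {mpoly K[10]} (@phi K) (@phi_inj K) E sl2_invariant 'X_a 'X_b) => //.
- by move=> k l s t; apply: X_pow_coprime.
- split=> [|f g|P f]; [exact: (invariantC 0)|exact: invariantD|].
  move=> If; apply: invariantM => //; apply: sl2_invariant_comp => i.
  by apply/invariant_theta/mem_tnth.
- by move=> f; apply: (loc a 1%N 2%N).
- by move=> f; apply: (loc b 3%N 4%N).
Qed.

Lemma theta_hsop : hsop (@invariant_ring K (V hK)) theta.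
Proof.
split=> [f ft||].
- by split; [exact: invariant_theta|exact: theta_homog].
- exact: theta_alg_independent.
have [r [Ir Hr]] := invariants_fg; exists r; split=> // f /Hr /gspanP [c E].
by exists c.
Qed.

End Invariants.

(** * Failure of the Cohen-Macaulay property *)

Section NotCohenMacaulay.
Variables (K : closedFieldType) (hK : 2%N \in [pchar K]).
Notation T := {mpoly K[10]}.
Notation FF := (@FF K).
Notation GG := (@GG K).
Notation vv := (@vv K).
Notation theta := (@theta K).
Notation act := (@sl2_act K hK).
Notation gg := (@gg K).
Notation inv := (@sl2_invariant K hK).

Definition trivializes (c v : T) := forall s, act s v - v = c * gg s.

Definition annihilator (c : T) := inv c /\ exists v, trivializes c v.

Lemma trivializes_FF i j : (0 < i < 5)%N -> (0 < j < 5)%N -> trivializes (FF i j) (vv i j).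
Proof. by move=> hi hj s; rewrite act_vv // addrC addKr. Qed.

Lemma annihilator_FF i j : (0 < i < 5)%N -> (0 < j < 5)%N -> annihilator (FF i j).
Proof.
by move=> hi hj; split; [exact: invariant_FF|exists (vv i j); exact: trivializes_FF].
Qed.

Lemma annihilator0 : annihilator 0.
Proof.
by split; [exact: (invariantC _ 0)|exists 0 => s; rewrite rmorph0 mul0r subrr].
Qed.

Lemma annihilatorD f g : annihilator f -> annihilator g -> annihilator (f + g).
Proof.
move=> [If [v Hv]] [Ig [w Hw]]; split; first exact: invariantD.
by exists (v + w) => s; rewrite rmorphD mulrDl -Hv -Hw /=; ring.
Qed.

Lemma annihilatorM f g : inv f -> annihilator g -> annihilator (f * g).
Proof.
move=> If [Ig [v Hv]]; split; first exact: invariantM.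
by exists (f * v) => s; rewrite rmorphM /= If -mulrA -Hv; ring.
Qed.

(** Both products move by [a b gg], so their difference is fixed. *)
Lemma invariant_minor a b v w : inv a -> inv b -> trivializes a v -> trivializes b w ->
  inv (a * w - b * v).
Proof.
move=> Ia Ib Hv Hw s; rewrite rmorphB !rmorphM /= Ia Ib.
by rewrite -[act s w](subrK w) -[act s v](subrK v) Hv Hw; ring.
Qed.

Lemma not_trivializes1 w : ~ trivializes 1 w.
Proof.
move=> H; apply: (@gg_not_coboundary K hK); exists w => s.
by rewrite -[LHS]mul1r -H.
Qed.

Lemma trivializes_cancel c w : c != 0 -> inv c -> trivializes c (c * w) -> trivializes 1 w.
Proof.
move=> nc Ic H s; apply: (mulfI nc); rewrite mul1r -H rmorphM /= Ic; ring.
Qed.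

Lemma trivializesD c v h : inv h -> trivializes c v -> trivializes c (v + h).
Proof. by move=> Ih H s; rewrite rmorphD /= Ih -H; ring. Qed.

Let n12 : FF 1 2 != 0. Proof. exact: FF_neq0. Qed.
Let n23 : FF 2 3 != 0. Proof. exact: FF_neq0. Qed.
Let I12 : inv (FF 1 2). Proof. exact: invariant_FF. Qed.
Let I23 : inv (FF 2 3). Proof. exact: invariant_FF. Qed.
Let I34 : inv (FF 3 4). Proof. exact: invariant_FF. Qed.
Let t12 : trivializes (FF 1 2) (vv 1 2). Proof. exact: trivializes_FF. Qed.
Let t23 : trivializes (FF 2 3) (vv 2 3). Proof. exact: trivializes_FF. Qed.
Let t34 : trivializes (FF 3 4) (vv 3 4). Proof. exact: trivializes_FF. Qed.

(** The leading monomials [X_1 Y_2] and [X_2 Y_3] share no variable. *)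
Lemma FF_coprime A B : FF 1 2 * B = FF 2 3 * A -> exists w, A = FF 1 2 * w.
Proof.
apply: coprime_lead_dvd => // i; rewrite !mlead_FF // !mnmDE !eeE //.
by move: (nat_of_ord i) => k; lia.
Qed.

Lemma not_regular :
  ~ regular_sequence (@invariant_ring K (V hK)) [:: FF 1 2; FF 2 3; FF 3 4].
Proof.
case=> _ _ /(_ 2%N isT (FF 1 2 * vv 2 3 - FF 2 3 * vv 1 2)) [||c [Ic]].
- exact: (invariant_minor I12 I23 t12 t23).
(* The coefficients come from expanding a [3 x 3] determinant with two equal rows
   [(f_12, f_23, f_34)] and third row the corresponding [vv]. *)
- exists (fun i => if i == 0 then FF 3 4 * vv 2 3 - FF 2 3 * vv 3 4
                   else FF 1 2 * vv 3 4 - FF 3 4 * vv 1 2).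
  split=> [i|].
    case: ifP => _; [rewrite -opprB; apply: invariantN|];
      [exact: (invariant_minor I23 I34 t23 t34)|exact: (invariant_minor I12 I34 t12 t34)].
  rewrite !big_ord_recl big_ord0 /=; ring.
rewrite !big_ord_recl big_ord0 addr0 /=; set c0 := c _; set c1 := c _ => E.
(* The invariants [c0] and [c1] correct the trivializing elements so that the minor vanishes and
   coprimality applies. *)
have [|w Ew] := @FF_coprime (vv 1 2 + c1) (vv 2 3 - c0).
  apply/eqP; rewrite -subr_eq0; apply/eqP.
  transitivity (FF 1 2 * vv 2 3 - FF 2 3 * vv 1 2 - (c0 * FF 1 2 + c1 * FF 2 3)); first by ring.
  by rewrite E subrr.
apply: (@not_trivializes1 w); apply: (trivializes_cancel n12 I12).
by rewrite -Ew; apply: trivializesD => //; apply: Ic.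
Qed.

Lemma invariants_dependent (r : nat) (I : T -> Prop) (z : r.-tuple T) (b : seq T) :
  I 0 -> (forall f g, I f -> I g -> I (f + g)) -> (forall f g, inv f -> I g -> I (f * g)) ->
  (forall f, f \in b -> inv f) -> (forall i, inv (tnth z i)) ->
  (forall f, inv f -> exists2 g, gspan (comp_mpoly z) b g & I (f - g)) ->
  forall m (x : m.-tuple T), (r < m)%N -> (forall i, inv (tnth x i)) ->
  exists2 P : {mpoly K[m]}, P != 0 & I (P \mPo x).
Proof.
move=> I0 ID IM Ib Iz gen m x.
apply: (dependent_mod (R := inv) (z := z) (b := b)) => //.
- exact: invariantC.
- exact: invariantM.
- exact: invariantD.
Qed.

(** * Contradiction from a basis of the invariants over an hsop *)

Section Basis.
Variables (s b : seq T).
Hypothesis hs : hsop (@invariant_ring K (V hK)) s.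
Hypothesis hb : subalg_basis (@invariant_ring K (V hK)) s b.
Notation S := {mpoly K[size s]}.

Definition psi : S -> T := comp_mpoly (in_tuple s).
HB.instance Definition _ := GRing.RMorphism.on psi.

Let psi0 P : psi P = 0 -> P = 0.
Proof. by case: hs => _ H _; apply: H. Qed.

Let inv_psi P : inv (psi P).
Proof.
apply: (@sl2_invariant_comp K hK _ (in_tuple s) P) => i.
by case: hs => H _ _; have [] := H _ (mem_tnth i (in_tuple s)).
Qed.

Let inv_b f : f \in b -> inv f.
Proof. by case: hb => -[H _] _; apply: H. Qed.

Let coords f : inv f -> exists c : 'I_(size b) -> S, f = \sum_(i < size b) psi (c i) * b`_i.
Proof. by case: hb => -[_ H] _ /H [c E]; exists c. Qed.

Let coords0 (c : 'I_(size b) -> S) : \sum_(i < size b) psi (c i) * b`_i = 0 -> forall i, c i = 0.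
Proof. by case: hb => _ H E i; apply: psi0; apply: (H c). Qed.

(* Membership in the ideal of the invariant ring generated by psi(a), expressed in the basis b. *)
Definition extended (a : seq S) (f : T) := exists2 c : 'I_(size b) -> S,
  forall i, gspan idfun a (c i) & f = \sum_(i < size b) psi (c i) * b`_i.

Lemma extendedD a f g : extended a f -> extended a g -> extended a (f + g).
Proof.
move=> [c Hc ->] [d Hd ->]; exists (fun i => c i + d i) => [i|]; first exact: gspanD.
by rewrite -big_split; apply: eq_bigr => i _; rewrite rmorphD mulrDl.
Qed.

Lemma extended_mem a x f : x \in a -> inv f -> extended a (psi x * f).
Proof.
move=> xa /coords [c ->]; exists (fun i => c i * x) => [i|].
  exact/(gspanM (phi := idfun))/gspan_mem.
by rewrite mulr_sumr; apply: eq_bigr => i _; rewrite rmorphM /=; ring.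
Qed.

(** By freeness, multiplication by [psi x] acts on each coordinate separately, so regularity passes
    from the polynomial ring to the invariants. *)
Lemma extended_regular a x f : (forall h, gspan idfun a (x * h) -> gspan idfun a h) ->
  inv f -> extended a (psi x * f) -> extended a f.
Proof.
move=> reg /coords [h Eh] [c Hc E]; exists h => // i; apply: reg.
suff -> : x * h i = c i by [].
apply/eqP; rewrite -subr_eq0; apply/eqP; move: i.
apply: (coords0 (c := fun i => x * h i - c i)).
under eq_bigr do rewrite rmorphB rmorphM mulrBl.
rewrite sumrB -E Eh mulr_sumr; apply/eqP; rewrite subr_eq0; apply/eqP.
by apply: eq_bigr => i _; rewrite mulrA.
Qed.

Lemma extended2 x y f : extended [:: x; y] f ->
  exists k l, [/\ inv k, inv l & f = psi x * k + psi y * l].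
Proof.
case=> c Hc ->.
pose Q f := exists k l, [/\ inv k, inv l & f = psi x * k + psi y * l].
apply: (big_ind Q) => [|f1 f2 [k1 [l1 [? ? ->]]] [k2 [l2 [? ? ->]]]|i _].
- by exists 0, 0; split; [exact: (invariantC _ 0)|exact: (invariantC _ 0)|rewrite !mulr0 addr0].
- by exists (k1 + k2), (l1 + l2); split; [exact: invariantD|exact: invariantD|ring].
have /= [p [q E]] := Hc i; exists (psi p * b`_i), (psi q * b`_i).
have Ib : inv b`_i by apply/inv_b/mem_nth.
split; [exact: invariantM|exact: invariantM|].
have -> : c i = p * x + q * y.
  by apply/eqP; rewrite -subr_eq0 opprD addrA; apply/eqP.
by rewrite rmorphD !rmorphM /=; ring.
Qed.

Lemma extended1 x f : extended [:: x] f -> exists2 k, inv k & f = psi x * k.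
Proof.
move=> [c Hc E].
have [k [l [Ik Il Ef]]] : exists k l, [/\ inv k, inv l & f = psi x * k + psi 0 * l].
  apply: extended2; exists c => // i; have /= [p Ep] := Hc i.
  by exists p, 0; rewrite mul0r subr0.
by exists k => //; rewrite Ef rmorph0 mul0r addr0.
Qed.

(** Over fewer than seven parameters the seven elements of [theta] would be dependent, by the
    counting argument with the zero ideal. *)
Lemma size_hsop : (7 <= size s)%N.
Proof.
rewrite leqNgt; apply/negP => lt7.
have Iz i : inv (tnth (in_tuple s) i).
  by case: hs => H _ _; have [] := H _ (mem_tnth i (in_tuple s)).
have [|f g -> ->|f g _ ->|f If|i|P nP] :=
  @invariants_dependent (size s) (fun f => f = 0) (in_tuple s) b _ _ _ inv_b Iz _ 7 (in_tuple theta) lt7.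
- by [].
- by rewrite addr0.
- by rewrite mulr0.
- exists f; last exact: subrr.
  by apply/gspanP; apply: coords.
- by apply/invariant_theta/mem_tnth.
by move/(@theta_alg_independent K)/eqP; rewrite (negPf nP).
Qed.

(** The first three members of [theta] annihilate [gg], so modulo the annihilator the invariants are
    spanned over the algebra of the last four. *)
Lemma annihilator_dependent (m : nat) (x : m.-tuple T) : (4 < m)%N ->
  (forall i, inv (tnth x i)) -> exists2 P : {mpoly K[m]}, P != 0 & annihilator (P \mPo x).
Proof.
have [r [Ir Hr]] := invariants_fg hK.
pose z : 4.-tuple T := [tuple GG 1; GG 4; theta_sum K 2 1 3 1 4; theta_sum K 3 2 4 1 4].
have Iz i : inv (tnth z i).
  apply: invariant_theta; have := mem_tnth i z; rewrite !inE => ->.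
  by rewrite !orbT.
apply: (@invariants_dependent 4 annihilator z r annihilator0 annihilatorD annihilatorM Ir Iz) => f /Hr.
(* The substitution that kills the first three parameters and renames the other four; [red] says
   that it changes nothing modulo the annihilator. *)
pose sg : 7.-tuple {mpoly K[4]} := [tuple 0; 0; 0; 'X_0; 'X_1; 'X_2; 'X_3].
have red (P : {mpoly K[7]}) : annihilator (phi P - ((P \mPo sg) \mPo z)).
  have Iphi Q : inv (phi Q).
    by apply: (@sl2_invariant_comp K hK _ (in_tuple theta) Q) => i; apply/invariant_theta/mem_tnth.
  have Iz' Q : inv (Q \mPo z) by apply: sl2_invariant_comp.
  move: P; apply: mpoly_alg_ind => [c|i|P Q HP HQ|P Q HP HQ].
  - by rewrite /phi !comp_mpolyC subrr; apply: annihilator0.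
  - have -> : 'X_i \mPo sg = tnth sg i by rewrite comp_mpolyXU -tnth_nth.
    rewrite (phiX i) (tnth_nth 0).
    have XE (j : 'I_4) : 'X_j \mPo z = z`_j by rewrite comp_mpolyXU.
    case: i => [[|[|[|[|[|[|[|i]]]]]]] i7]; last by discriminate i7.
    + by rewrite rmorph0 subr0; apply: annihilator_FF.
    + by rewrite rmorph0 subr0; apply: annihilator_FF.
    + by rewrite rmorph0 subr0; apply: annihilator_FF.
    + by rewrite XE subrr; apply: annihilator0.
    + by rewrite XE subrr; apply: annihilator0.
    + by rewrite XE subrr; apply: annihilator0.
    + by rewrite XE subrr; apply: annihilator0.
  - have := annihilatorD HP HQ; congr annihilator; rewrite [phi (P + Q)]rmorphD [(P + Q) \mPo sg]rmorphD [(_ + _) \mPo z]rmorphD /=.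
    by rewrite opprD addrACA.
  have := annihilatorD (annihilatorM (Iphi Q) HP) (annihilatorM (Iz' (P \mPo sg)) HQ).
  congr annihilator; rewrite [phi (P * Q)]rmorphM [(P * Q) \mPo sg]rmorphM [(_ * _) \mPo z]rmorphM /=.
  move: (phi P) (phi Q) (_ \mPo z) (_ \mPo z) => a b' c d; ring.
pose Qf f := exists2 g, gspan (comp_mpoly z) r g & annihilator (f - g).
apply: (gspan_ind (P := Qf)) => [|f1 f2 [g1 Hg1 A1] [g2 Hg2 A2]|P h hr].
- by exists 0; [exact: (gspan0 (comp_mpoly z))|rewrite subrr; apply: annihilator0].
- exists (g1 + g2); first exact: gspanD.
  by have := annihilatorD A1 A2; congr annihilator; ring.
exists (((P \mPo sg) \mPo z) * h); first by apply: (gspanM (phi := comp_mpoly z)); apply: gspan_mem.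
rewrite -mulrBl mulrC; apply: annihilatorM; [exact: Ir|exact: red].
Qed.

Lemma annihilator_regular_sequence : exists a1 a2 a3 : S, a1 != 0 /\
  [/\ annihilator (psi a1), annihilator (psi a2), annihilator (psi a3),
     forall h, gspan idfun [:: a1] (a2 * h) -> gspan idfun [:: a1] h &
     forall h, gspan idfun [:: a2; a1] (a3 * h) -> gspan idfun [:: a2; a1] h].
Proof.
have [||m x m4|a [sa Ha] ra] :=
  @exists_regular_sequence K 4 3 (size s) (fun P => annihilator (psi P)).
- exact: size_hsop.
- split=> [|P Q HP HQ|P Q HQ]; rewrite ?rmorph0 ?rmorphD ?rmorphM //=.
  + exact: annihilator0.
  + exact: annihilatorD.
  + exact: annihilatorM.
- have [|P nP HP] := @annihilator_dependent m [tuple of map psi x] m4.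
    by move=> i; rewrite tnth_map.
  exists P => //; move: HP; congr annihilator.
  apply: (mpoly_rmorph_ext (h1 := comp_mpoly _) (h2 := psi \o comp_mpoly x)) => [c|i] /=.
    by rewrite /psi !comp_mpolyC.
  by rewrite !comp_mpolyXU -!tnth_nth tnth_map.
case: a => [|a3 [|a2 [|a1 [|a0 a]]]] // in sa Ha ra *.
have [r3 [r2 [r1 _]]] := ra.
exists a1, a2, a3; split; last by split=> //; apply: Ha; rewrite !inE eqxx ?orbT.
(* If [a1] were zero, its regularity modulo the zero ideal would give [1 = 0]. *)
by apply/eqP=> a0; have := r1 1; rewrite a0 mul0r => /(_ erefl)/eqP; rewrite oner_eq0.
Qed.

Lemma basis_absurd : False.
Proof.
have [a1 [a2 [a3 [na1 [[I1 [v1 t1]] [I2 [v2 t2]] [I3 [v3 t3]] r2 r3]]]]] := annihilator_regular_sequence.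
pose u := psi a1 * v2 - psi a2 * v1.
have Iu : inv u by apply: invariant_minor.
have : extended [:: a2; a1] (psi a3 * u).
  rewrite (_ : psi a3 * u = psi a1 * (psi a3 * v2 - psi a2 * v3) + psi a2 * (psi a1 * v3 - psi a3 * v1)).
    apply: extendedD.
      apply: extended_mem; first by rewrite !inE eqxx orbT.
      by rewrite -opprB; apply: invariantN; apply: invariant_minor.
    apply: extended_mem; first exact: mem_head.
    exact: invariant_minor.
  by rewrite /u; ring.
move=> /(extended_regular r3 Iu) /extended2 [h2 [h1 [Ih2 Ih1 Eu]]].
pose N1 := v1 + h2; pose N2 := v2 - h1.
have EN : psi a1 * N2 = psi a2 * N1.
  apply/eqP; rewrite -subr_eq0; apply/eqP.
  transitivity (u - (psi a2 * h2 + psi a1 * h1)); first by rewrite /u /N1 /N2; ring.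
  by rewrite Eu subrr.
have tN1 : trivializes (psi a1) N1 by apply: trivializesD.
have tN2 : trivializes (psi a2) N2 by apply: trivializesD => //; apply: invariantN.
have n1 : psi a1 != 0.
  by apply: contra na1 => /eqP/psi0->.
(* The minor [f N1 - psi a1 v] is invariant, and [EN] makes its product with [psi a2] a multiple of
   [psi a1] by an invariant; regularity of [a2] modulo [a1] finishes. *)
have div f v : inv f -> trivializes f v -> exists A, f * N1 = psi a1 * A.
  move=> If tf.
  have IZ1 : inv (f * N1 - psi a1 * v) by apply: invariant_minor.
  have IZ2 : inv (f * N2 - psi a2 * v) by apply: invariant_minor.
  have : extended [:: a1] (psi a2 * (f * N1 - psi a1 * v)).
    rewrite (_ : _ * _ = psi a1 * (f * N2 - psi a2 * v)).
      by apply: extended_mem => //; apply: mem_head.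
    rewrite mulrBr mulrCA -EN; ring.
  move=> /(extended_regular r2 IZ1) /extended1 [z Iz Ez].
  by exists (v + z); rewrite [RHS]mulrDr -Ez; ring.
have [A EA] := div _ _ I12 t12; have [B EB] := div _ _ I23 t23.
have [|w Ew] := @FF_coprime A B.
  by apply: (mulfI n1); rewrite mulrCA -EB [RHS]mulrCA -EA; ring.
apply: (@not_trivializes1 w); apply: (trivializes_cancel n1 I1).
suff <- : N1 = psi a1 * w by [].
by apply: (mulfI n12); rewrite EA Ew; ring.
Qed.

End Basis.
End NotCohenMacaulay.

Theorem mainTheorem2 (K : closedFieldType) (hK : 2%N \in [pchar K]) :
  [/\ gm_dim (V hK) = 10%N,
      gm_iso (V hK) (dual (V hK)),
      ~ cohen_macaulay (@invariant_ring K (V hK))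
    & [/\ forall f, f \in [:: f_ hK 1 2; f_ hK 2 3; f_ hK 3 4] ->
            f \is 2.-homog /\ invariant_ring f,
          exists g : SL2 K -> {mpoly K[gm_dim (V hK)]},
            [/\ forall s, in_sq_submodule (g s),
                nontrivial_in_H1 (@coord_act K (V hK)) g
              & forall f, f \in [:: f_ hK 1 2; f_ hK 2 3; f_ hK 3 4] ->
                  annihilates f g],
          partial_hsop (@invariant_ring K (V hK))
            [:: f_ hK 1 2; f_ hK 2 3; f_ hK 3 4]
        & ~ regular_sequence (@invariant_ring K (V hK))
              [:: f_ hK 1 2; f_ hK 2 3; f_ hK 3 4]]].
Proof.
have fP (P : {mpoly K[10]} -> Prop) : P (FF K 1 2) -> P (FF K 2 3) -> P (FF K 3 4) ->
    forall f, f \in [:: FF K 1 2; FF K 2 3; FF K 3 4] -> P f.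
  by move=> P12 P23 P34 f; rewrite !inE => /or3P[] /eqP->.
split=> //.
- exact: V_self_dual.
- by case=> s [hs [b hb]]; apply: (@basis_absurd K hK s b hs hb).
split.
- by apply: fP; (split; [exact: FF_homog|move=> s; apply: (act_FF hK)]).
- exists (@gg K); split=> [s||].
  + by exists (SL2val s 0 0 * SL2val s 0 1), (SL2val s 1 0 * SL2val s 1 1).
  + by split; [exact: gg_cocycle|exact: gg_not_coboundary].
  have ann i j : (0 < i < 5)%N -> (0 < j < 5)%N -> @annihilates K (V hK) (FF K i j) (@gg K).
    move=> hi hj; split; first by move=> s; apply: act_FF.
    by exists (vv K i j) => s; apply/esym/(@trivializes_FF K hK).
  by apply: fP; apply: ann.
(* These are the last four members of [theta], which begins with the three given forms. *)
- exists [:: GG K 1; GG K 4; theta_sum K 2 1 3 1 4; theta_sum K 3 2 4 1 4]; exact: theta_hsop.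
- exact: not_regular.
Qed.
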